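(* Let $\mathcal{G}=(\mathcal{V},\mathcal{A},s,t,\mathcal{T})$ be a simplified series-parallel network with arcs $a_1,\dots,a_{n_a}$ and arc distances $c\in\mathbb{R}_+^{n_a}$, let $\mathcal{A}_a\subseteq\mathcal{A}$ be a set of attackable arcs, and let $\delta\in\mathbb{R}_+^{n_a}$ with $\delta_j>0$ if $a_j\in\mathcal{A}_a$ and $\delta_j=0$ otherwise. For $x\in\{0,1\}^{n_a}$ let $\phi(x)$ be the shortest $s$–$t$ distance in $\mathcal{G}$ with arc distances $c+\mathrm{diag}(\delta)x$. Denote by $\mathcal{A}_{P_s}$ the set of arcs of the shortest $s$–$t$ path $P_s$ under no attacks ($x=0$). Then: (i) $\phi$ is supermodular if and only if $\mathcal{A}_a\cap\mathcal{A}_{P_s}=\emptyset$ or the following two conditions are satisfied: 1) for all $\mathcal{A}'\subseteq\mathcal{A}_a\cap\mathcal{A}_{P_s}$ with $|\mathcal{A}'|=2$, all $(\mathcal{A}'|\emptyset)$-parallel arcs are $\mathcal{A}_a$-robust redundant; and 2) for all $a_k\in\mathcal{A}_a\cap\mathcal{A}_{P_s}$ with corresponding $(\{a_k\}|(\mathcal{A}_a\cap\mathcal{A}_{P_s}))$-parallel subnetwork $g_k$, if $g_k$ exists, then the shortest distance between the source and sink nodes of $g_k$ is supermodular in $x_{g_k}$ when $a_k$ is attacked ($x_k=1$), where $x_{g_k}$ consists of the entries of $x$ related to the attackable arcs in $g_k$. (ii) $\phi$ is submodular if and only if $\mathcal{A}_a\cap\mathcal{A}_{P_s}=\emptyset$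 or all arcs in $\mathcal{A}_a\setminus\mathcal{A}_{P_s}$ are $\mathcal{A}_a$-robust redundant.
   Context: Series-parallel networks (SPNs). A two-terminal graph has a node set, an arc set, a source $s$, a sink $t$, and an incidence relation $\mathcal{T}\subseteq\mathcal{V}\times\mathcal{A}\times\mathcal{V}$ giving the tail and head of each arc. SPNs are defined inductively: a single arc from $s$ to $t$ is an SPN; if $\mathcal{G}_1,\mathcal{G}_2$ are SPNs, so are their series composition (identify the sink $t_1$ of $\mathcal{G}_1$ with the source $s_2$ of $\mathcal{G}_2$; source $s_1$, sink $t_2$) and their parallel composition (identify $s_1$ with $s_2$ and $t_1$ with $t_2$; source $s_1$, sink $t_1$). Two distinct arcs of an SPN are in series if some $s$–$t$ path contains both; strictly in series if every $s$–$t$ path containing one contains the other; in parallel if no $s$–$t$ path contains both. Simplified SPN: the following reductions are applied to non-attackable arcs $a_j$ until no arc is removable. Series: if $a_j$ and some arc $a_k$ are strictly in series, remove $a_j$ by merging its two incident nodes and replace $c_k$ by $c_k+c_j$. Parallel: if $a_j$ and some arc $a_k$ are in parallel and share their incident nodes, remove $a_j$ and replace $c_k$ by $\min\{c_j,c_k\}$ and $\delta_k$ by $\min\{c_j,c_k+\delta_k\}-\min\{c_j,c_k\}$. $\phi$ is equivalently the shortest path linear program $\phi(x)=\min\{(c+\mathrm{diag}(\delta)x)^\top y: Ty=d,\ y\ge0\}$, with $T$ the node-arc incidence matrix ($-1$ at the tail, $+1$ at the head) and $d_s=-1$, $d_t=1$, $d_i=0$ otherwise. Robust redundancy: for $\mathcal{X}\subseteq\mathcal{A}_a$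 let $\psi_{\mathcal{G}}(\mathcal{X})$ be the shortest $s$–$t$ distance in $\mathcal{G}$ when exactly the arcs in $\mathcal{X}$ are attacked. An arc $a_j\in\mathcal{A}$ is $\mathcal{A}_a$-robust redundant if $\psi_{\mathcal{G}}(\mathcal{X})=\psi_{\mathcal{G}\setminus\{a_j\}}(\mathcal{X}\setminus\{a_j\})$ for all $\mathcal{X}\subseteq\mathcal{A}_a$, where $\mathcal{G}\setminus\{a_j\}$ is $\mathcal{G}$ with $a_j$ deleted. Conditional parallelism: for $\mathcal{A}_1,\mathcal{A}_2\subseteq\mathcal{A}$, an arc $a$ is $(\mathcal{A}_1|\mathcal{A}_2)$-parallel if $a$ is in parallel with all arcs in $\mathcal{A}_1$ but is not in parallel with any arc in $\mathcal{A}_2\setminus\mathcal{A}_1$. If $|\mathcal{A}_1|=1$, the $(\mathcal{A}_1|\mathcal{A}_2)$-parallel subnetwork $g$ consists of all $(\mathcal{A}_1|\mathcal{A}_2)$-parallel arcs together with their incident nodes (it does not exist if there are no such arcs). A node $v$ in $g$ is the source or sink node of $g$ if every $s$–$t$ path containing an arc in $g$ passes through $v$. In condition 2), the shortest distance between the source and sink nodes of $g_k$ is taken in $\mathcal{G}$ with $x_k=1$, as a function of $x_{g_k}$, the remaining entries of $x$ being held fixed. A function $\phi$ on a sublattice is supermodular if $\phi(x')+\phi(x'')\le\phi(x'\vee x'')+\phi(x'\wedge x'')$ for all $x',x''$ (componentwise max/min), and submodular if the reverse inequality always holds. Standing assumption: for every $x$ the shortest path problem is feasible and bounded.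
   Formalization: In (i), the shortest path under no attacks is assumed unique, and either shortest paths are unique under every attack, or condition 1) asks that the (A'|∅)-parallel arcs be redundant jointly (all deleted at once); source/sink of g_k are the nodes met before/after all its arcs. *)

(* Defs.v *)
(* The reals are an arbitrary [R : realType] and distances are extended reals,
   so that two disconnected nodes are at distance +oo. *)
From HB Require Import structures.
From mathcomp Require Import all_boot all_order all_algebra.
From mathcomp Require Import constructive_ereal reals.

Set Implicit Arguments.
Unset Strict Implicit.
Unset Printing Implicit Defensive.

Import Order.TTheory GRing.Theory Num.Theory.
Local Open Scope ring_scope.

(* The incidence relation is given by the tail and the head of each arc. Several
   arcs may have the same tail and head. *)
Record network := Network {
  nodes : finType;
  arcs : finType;
  source : nodes;
  sink : nodes;
  tail_of : arcs -> nodes;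
  head_of : arcs -> nodes }.

Arguments source : clear implicits.
Arguments sink : clear implicits.

(* [spn_on N E u v]: the nodes N and the arcs E of G form a series-parallel
   network with source u and sink v. The compositions are expressed inside G:
   gluing two networks at the terminals being identified means that their arc
   sets are disjoint and that they share no other node. A single arc has two
   distinct terminals. *)
Inductive spn_on (G : network) :
    {set nodes G} -> {set arcs G} -> nodes G -> nodes G -> Prop :=
| SpnArc a : tail_of a != head_of a ->
    spn_on [set tail_of a; head_of a] [set a] (tail_of a) (head_of a)
| SpnSeries N1 N2 E1 E2 u m v :
    spn_on N1 E1 u m -> spn_on N2 E2 m v ->
    E1 :&: E2 = set0 -> N1 :&: N2 = [set m] ->
    spn_on (N1 :|: N2) (E1 :|: E2) u v
| SpnParallel N1 N2 E1 E2 u v :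
    spn_on N1 E1 u v -> spn_on N2 E2 u v ->
    E1 :&: E2 = set0 -> N1 :&: N2 = [set u; v] ->
    spn_on (N1 :|: N2) (E1 :|: E2) u v.

Definition series_parallel (G : network) : Prop :=
  @spn_on G [set: nodes G] [set: arcs G] (source G) (sink G).

Section Paths.
Variable G : network.
Implicit Types (u v : nodes G) (a b : arcs G) (E S : {set arcs G}).

Fixpoint walk u (p : seq (arcs G)) v : bool :=
  if p is a :: q then (tail_of a == u) && walk (head_of a) q v else u == v.

Definition nodes_from u (p : seq (arcs G)) : seq (nodes G) :=
  u :: map (@head_of G) p.

Definition is_path u v (p : seq (arcs G)) : bool :=
  walk u p v && uniq (nodes_from u p).

(* A path does not repeat nodes, hence has at most #|arcs G| arcs; bounding the
   length makes the type of candidate paths finite. *)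
Notation arcseq := (#|arcs G|.-bseq (arcs G)).

Definition arcset (p : seq (arcs G)) : {set arcs G} := [set a in p].

Definition st_path (p : seq (arcs G)) : bool :=
  is_path (source G) (sink G) p.

Definition strictly_in_series a b : bool :=
  (a != b) &&
  [forall p : arcseq, st_path p ==> ((a \in arcset p) == (b \in arcset p))].

Definition in_parallel a b : bool :=
  (a != b) &&
  [forall p : arcseq, st_path p ==> ~~ ((a \in arcset p) && (b \in arcset p))].

Definition ends a : {set nodes G} := [set tail_of a; head_of a].

Definition removable a : bool :=
  [exists b, strictly_in_series a b] ||
  [exists b, in_parallel a b && (ends a == ends b)].

(* The reductions have been carried out to the end: no non-attackable arc can
   be removed any more. *)
Definition simplified_spn (Aa : {set arcs G}) : Prop :=
  series_parallel G /\ forall a, a \notin Aa -> ~~ removable a.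

(* The set of the (E1|E2)-parallel arcs. *)
Definition cond_parallel (E1 E2 : {set arcs G}) : {set arcs G} :=
  [set a | [forall b in E1, in_parallel a b] &&
           [forall b in E2 :\: E1, ~~ in_parallel a b]].

Definition incident_nodes E : {set nodes G} := \bigcup_(a in E) ends a.

(* Position of v on an s-t path through v; the first [pos v p] arcs of p come
   before v. *)
Definition pos v (p : seq (arcs G)) : nat :=
  index v (nodes_from (source G) p).

Definition passes_through (p : seq (arcs G)) v : bool :=
  v \in nodes_from (source G) p.

(* Every s-t path meeting g passes through each terminal of g. Inner cut nodes
   of g have this property too; the source is the one met before all arcs of g
   and the sink the one met after them. *)
Definition subnet_source (g : {set arcs G}) u : Prop :=
  u \in incident_nodes g /\
  forall p : arcseq, st_path p -> arcset p :&: g != set0 ->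
    passes_through p u /\
    forall a, a \in take (pos u p) p -> a \notin g.

Definition subnet_sink (g : {set arcs G}) v : Prop :=
  v \in incident_nodes g /\
  forall p : arcseq, st_path p -> arcset p :&: g != set0 ->
    passes_through p v /\
    forall a, a \in drop (pos v p) p -> a \notin g.

End Paths.

Notation arcseq G := (#|arcs G|.-bseq (arcs G)).

Section Distances.
Variables (R : realType) (G : network).
Implicit Types (w c delta : arcs G -> R) (x y z : {ffun arcs G -> bool}).
Implicit Types (E X S : {set arcs G}).

Definition path_length w (p : seq (arcs G)) : R := \sum_(a <- p) w a.

Definition shortest_path w (p : arcseq G) : Prop :=
  st_path p /\
  forall q : arcseq G, st_path q -> path_length w p <= path_length w q.

Definition unique_shortest_path w : Prop :=
  forall p q : arcseq G, shortest_path w p -> shortest_path w q -> p = q.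

(* Shortest distance from u to v using arcs of E only; +oo if there is no such
   path. *)
Definition dist E w (u v : nodes G) : \bar R :=
  \big[Order.min/+oo%E]_(p : arcseq G |
      is_path u v p && (arcset p \subset E))
    (path_length w p)%:E.

Definition attacked c delta x : arcs G -> R :=
  fun a => c a + delta a * (x a)%:R.

Definition no_attack : {ffun arcs G -> bool} := [ffun=> false].

Definition phi c delta x : \bar R :=
  dist [set: arcs G] (attacked c delta x) (source G) (sink G).

(* The shortest s-t distance once the arcs of S are deleted, when exactly the
   arcs of X are attacked. *)
Definition psi c delta S X : \bar R :=
  dist (~: S) (attacked c delta [ffun a => a \in X]) (source G) (sink G).

Definition robust_redundant c delta (Aa : {set arcs G}) (a : arcs G) : Prop :=
  forall X, X \subset Aa ->
    psi c delta set0 X = psi c delta [set a] (X :\ a).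

(* All the arcs of S can be deleted at once. This is stronger than the robust
   redundancy of each arc of S: two arcs may each be redundant only because the
   other one provides an equally short alternative. *)
Definition jointly_robust_redundant c delta (Aa S : {set arcs G}) : Prop :=
  forall X, X \subset Aa -> psi c delta set0 X = psi c delta S (X :\: S).

Definition join_attack x y : {ffun arcs G -> bool} := [ffun a => x a || y a].
Definition meet_attack x y : {ffun arcs G -> bool} := [ffun a => x a && y a].

Definition supermodular (f : {ffun arcs G -> bool} -> \bar R) : Prop :=
  forall x y, (f x + f y <= f (join_attack x y) + f (meet_attack x y))%E.

Definition submodular (f : {ffun arcs G -> bool} -> \bar R) : Prop :=
  forall x y, (f (join_attack x y) + f (meet_attack x y) <= f x + f y)%E.

(* The attack vector with the entries y on S and z elsewhere; a function of y
   through [override S y z] is a function of the entries in S alone. *)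
Definition override S y z : {ffun arcs G -> bool} :=
  [ffun a => if a \in S then y a else z a].

(* In the conditions below, K is the set of the attackable arcs of the shortest
   path under no attacks. *)
Definition condition1 c delta (Aa K : {set arcs G}) : Prop :=
  forall A' : {set arcs G}, A' \subset K -> #|A'| = 2%N ->
    forall a, a \in cond_parallel A' set0 -> robust_redundant c delta Aa a.

Definition joint_condition1 c delta (Aa K : {set arcs G}) : Prop :=
  forall A' : {set arcs G}, A' \subset K -> #|A'| = 2%N ->
    jointly_robust_redundant c delta Aa (cond_parallel A' set0).

(* z provides the entries that are held fixed: the entry of k is 1, the others
   are arbitrary. *)
Definition condition2 c delta (Aa K : {set arcs G}) : Prop :=
  forall k, k \in K ->
    let g := cond_parallel [set k] K in
    g != set0 ->
    exists u v, [/\ subnet_source g u, subnet_sink g v &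
      forall z, z k ->
        supermodular (fun y =>
          dist [set: arcs G] (attacked c delta (override (g :&: Aa) y z)) u v)].

End Distances.

(* Main.v *)
Require Import Defs.
From mathcomp Require Import all_boot all_order all_algebra.
From mathcomp Require Import constructive_ereal reals.
From mathcomp Require Import ring lra.

Set Implicit Arguments.
Unset Strict Implicit.
Unset Printing Implicit Defensive.

Import Order.TTheory GRing.Theory Num.Theory.
Local Open Scope ring_scope.

(** A series-parallel network is the value of a tree of series and parallel
    compositions, and the shortest distance is evaluated along this tree: a sum
    at a series composition, a minimum at a parallel one. Two arcs are in
    parallel exactly when no path contains both, which the tree decides at
    their lowest common ancestor. All three equivalences are proved on the
    tree; [spn_tree] produces it.

    Supermodularity, necessity of the first condition
    ([supermod_pairs_redundant]). Let k1 and k2 be attackable arcs of the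
    shortest path, and attack both besides any other arcs. Supermodularity
    makes the effect of attacking k1 at least as large as it is in the absence
    of other attacks, hence positive; so every shortest path that arises when
    k1 alone is spared uses k1, and likewise for k2. Exchange the two paths at
    a node separating k1 from k2 ([series_exchange]): one of the new paths
    collects k1 and k2, and supermodularity forces the other one to be as
    short as possible. It visits a node between k1 and k2, so that it avoids
    all arcs parallel to both, which are therefore jointly redundant.

    Second condition. If the arcs parallel to at least two arcs of K are
    redundant, then a parallel composition met by K at least twice has the
    distance of the factor containing K. What remains around an arc k of K is
    the largest component, the envelope of k, in which k is the only arc of K;
    its terminals are the source and the sink of g_k. The distance of the
    network is then a sum of the distances of these envelopes, up to a
    constant, and supermodularity of the sum is supermodularity of each term
    ([supermod_of_conditions], [envelope_exists]). The envelope has a constant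
    distance as long as k is spared, and otherwise the arcs that matter are
    those of g_k ([parallel_arcs_determine]); so the condition on g_k under an
    attack of k is what is needed.

    If shortest paths are unique under every attack, then separate redundancy
    of arcs amounts to joint redundancy ([condition1_joint]).

    Submodularity. An attack on an arc off the shortest path has no effect by
    itself, so under submodularity it never has one, and the arc is redundant.
    Conversely, if these arcs are redundant then only attacks along the
    shortest path matter; for these, the components off the path have constant
    distance, and the minimum of a monotone submodular function and a constant
    is submodular ([submod_along_path]). *)

(** * Series-parallel trees and their paths *)

Section Trees.
Variable A : finType.
Implicit Types (a b k : A) (p q : seq A).

Inductive sp_tree := Leaf of A | Ser of sp_tree & sp_tree | Par of sp_tree & sp_tree.

Fixpoint supp (T : sp_tree) : {set A} :=
  match T with
  | Leaf a => [set a]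
  | Ser T1 T2 | Par T1 T2 => supp T1 :|: supp T2
  end.

Fixpoint linear_tree (T : sp_tree) : bool :=
  match T with
  | Leaf _ => true
  | Ser T1 T2 | Par T1 T2 =>
      [&& linear_tree T1, linear_tree T2 & [disjoint supp T1 & supp T2]]
  end.

Fixpoint paths (T : sp_tree) : seq (seq A) :=
  match T with
  | Leaf a => [:: [:: a]]
  | Ser T1 T2 => [seq p ++ q | p <- paths T1, q <- paths T2]
  | Par T1 T2 => paths T1 ++ paths T2
  end.

Inductive subtree (Q : sp_tree) : sp_tree -> Prop :=
| SubRefl : subtree Q Q
| SubSerL T1 T2 : subtree Q T1 -> subtree Q (Ser T1 T2)
| SubSerR T1 T2 : subtree Q T2 -> subtree Q (Ser T1 T2)
| SubParL T1 T2 : subtree Q T1 -> subtree Q (Par T1 T2)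
| SubParR T1 T2 : subtree Q T2 -> subtree Q (Par T1 T2).

(** The complement of parallelism. Unlike the usual relation between arcs in
    series it is reflexive. *)
Definition in_series (T : sp_tree) a b : bool :=
  has (fun p => (a \in p) && (b \in p)) (paths T).

Lemma path_SerP T1 T2 p :
  reflect (exists p1 p2, [/\ p1 \in paths T1, p2 \in paths T2 & p = p1 ++ p2])
          (p \in paths (Ser T1 T2)).
Proof.
apply: (iffP allpairsP) => [[[p1 p2] [/= h1 h2 ->]]|[p1 [p2 [h1 h2 ->]]]].
  by exists p1, p2.
by exists (p1, p2).
Qed.

Lemma path_Ser_cat T1 T2 p1 p2 :
  p1 \in paths T1 -> p2 \in paths T2 -> p1 ++ p2 \in paths (Ser T1 T2).
Proof. by move=> h1 h2; apply/path_SerP; exists p1, p2. Qed.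

Lemma path_Par T1 T2 p :
  (p \in paths (Par T1 T2)) = (p \in paths T1) || (p \in paths T2).
Proof. exact: mem_cat. Qed.

Lemma path_exists T : exists p, p \in paths T.
Proof.
elim: T => [a|T1 [p1 h1] T2 [p2 h2]|T1 [p1 h1] T2 _].
- by exists [:: a]; rewrite inE.
- by exists (p1 ++ p2); exact: path_Ser_cat.
- by exists p1; rewrite path_Par h1.
Qed.

Lemma path_supp T p : p \in paths T -> {subset p <= supp T}.
Proof.
elim: T p => [a|T1 IH1 T2 IH2|T1 IH1 T2 IH2] p.
- by rewrite inE => /eqP -> b; rewrite !inE.
- move=> /path_SerP [p1 [p2 [h1 h2 ->]]] b.
  by rewrite mem_cat inE => /orP[/(IH1 _ h1)|/(IH2 _ h2)] ->; rewrite ?orbT.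
- rewrite path_Par => /orP[/IH1|/IH2] h b /h; rewrite inE => -> //.
  by rewrite orbT.
Qed.

Lemma path_nonempty T p : p \in paths T -> p != [::].
Proof.
elim: T p => [a|T1 IH1 T2 IH2|T1 IH1 T2 IH2] p.
- by rewrite inE => /eqP ->.
- by move=> /path_SerP [[|a p1] [p2 [/IH1 // _ _ ->]]].
- by rewrite path_Par => /orP[/IH1|/IH2].
Qed.

Lemma path_uniq T p : linear_tree T -> p \in paths T -> uniq p.
Proof.
elim: T p => [a|T1 IH1 T2 IH2|T1 IH1 T2 IH2] p /=.
- by move=> _; rewrite inE => /eqP ->.
- move=> /and3P[l1 l2 d] /path_SerP [p1 [p2 [h1 h2 ->]]].
  rewrite cat_uniq (IH1 _ l1 h1) (IH2 _ l2 h2) andbT /=.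
  apply/hasPn => a /(path_supp h2) a2; apply/negP => /(path_supp h1) a1.
  by rewrite (disjointFr d a1) in a2.
- by move=> /and3P[l1 l2 _]; rewrite path_Par => /orP[/(IH1 _ l1)|/(IH2 _ l2)].
Qed.

Lemma supp_on_path T a : a \in supp T -> exists2 p, p \in paths T & a \in p.
Proof.
elim: T => [b|T1 IH1 T2 IH2|T1 IH1 T2 IH2] /=.
- by move=> /set1P ->; exists [:: b]; rewrite inE.
- move=> /setUP[/IH1 [p hp ap]|/IH2 [p hp ap]].
    have [q hq] := path_exists T2.
    by exists (p ++ q); rewrite ?mem_cat ?ap //; exact: path_Ser_cat.
  have [q hq] := path_exists T1.
  by exists (q ++ p); rewrite ?mem_cat ?ap ?orbT //; exact: path_Ser_cat.
- by move=> /setUP[/IH1|/IH2] [p hp ap]; exists p; rewrite // path_Par hp ?orbT.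
Qed.

Lemma subtree_linear Q T : subtree Q T -> linear_tree T -> linear_tree Q.
Proof. by elim=> //= T1 T2 _ IH /and3P[l1 l2 _]; apply: IH. Qed.

Lemma subtree_supp Q T : subtree Q T -> supp Q \subset supp T.
Proof.
by elim=> [|T1 T2 _ h|T1 T2 _ h|T1 T2 _ h|T1 T2 _ h] //=;
  by apply: subset_trans h _; rewrite ?subsetUl ?subsetUr.
Qed.

(** A path that enters a component of the decomposition crosses it from its
    source to its sink, and the crossing can be exchanged for any other. *)
Lemma subtree_split Q T p a :
  linear_tree T -> subtree Q T -> p \in paths T -> a \in p -> a \in supp Q ->
  exists p1 q p2, [/\ p = p1 ++ q ++ p2, q \in paths Q,
    forall b, b \in p1 ++ p2 -> b \notin supp Q
    & forall q', q' \in paths Q -> p1 ++ q' ++ p2 \in paths T].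
Proof.
move=> l s; elim: s p l => {T} [|T1 T2 s IH|T1 T2 s IH|T1 T2 s IH|T1 T2 s IH] p.
- move=> _ hp _ _; exists [::], p, [::]; rewrite cats0; split=> // q' hq'.
  by rewrite cats0.
- move=> /= /and3P[l1 l2 d] /path_SerP[p1 [p2 [h1 h2 ->]]] ap aQ.
  have QT := subsetP (subtree_supp s).
  have a1 : a \in p1.
    move: ap; rewrite mem_cat => /orP[//|/(path_supp h2)].
    by rewrite (disjointFr d (QT _ aQ)).
  have [r1 [q [r2 [-> hq out ins]]]] := IH _ l1 h1 a1 aQ.
  exists r1, q, (r2 ++ p2); split=> //; first by rewrite !catA.
    move=> b; rewrite catA mem_cat => /orP[/out //|/(path_supp h2) b2].
    by apply: contraL b2 => /QT /(disjointFr d) ->.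
  by move=> q' /ins/path_Ser_cat/(_ h2); rewrite -!catA.
- move=> /= /and3P[l1 l2 d] /path_SerP[p1 [p2 [h1 h2 ->]]] ap aQ.
  have QT := subsetP (subtree_supp s).
  have a2 : a \in p2.
    move: ap; rewrite mem_cat => /orP[/(path_supp h1)|//].
    by rewrite (disjointFl d (QT _ aQ)).
  have [r1 [q [r2 [-> hq out ins]]]] := IH _ l2 h2 a2 aQ.
  exists (p1 ++ r1), q, r2; split=> //; first by rewrite !catA.
    move=> b; rewrite -catA mem_cat => /orP[/(path_supp h1) b1|/out //].
    by apply: contraL b1 => /QT /(disjointFl d) ->.
  by move=> q' /ins h; rewrite -catA; exact: path_Ser_cat.
- move=> /= /and3P[l1 l2 d]; rewrite -/(paths (Par T1 T2)) path_Par.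
  have QT := subsetP (subtree_supp s).
  case/orP=> [h1|/path_supp h2] ap aQ; last first.
    by move: (h2 _ ap); rewrite (disjointFr d (QT _ aQ)).
  have [r1 [q [r2 [-> hq out ins]]]] := IH _ l1 h1 ap aQ.
  by exists r1, q, r2; split=> // q' /ins; rewrite mem_cat => ->.
- move=> /= /and3P[l1 l2 d]; rewrite -/(paths (Par T1 T2)) path_Par.
  have QT := subsetP (subtree_supp s).
  case/orP=> [/path_supp h1|h2] ap aQ.
    by move: (h1 _ ap); rewrite (disjointFl d (QT _ aQ)).
  have [r1 [q [r2 [-> hq out ins]]]] := IH _ l2 h2 ap aQ.
  by exists r1, q, r2; split=> // q' /ins; rewrite mem_cat => ->; rewrite orbT.
Qed.

Lemma in_seriesP T a b :
  reflect (exists2 p, p \in paths T & a \in p /\ b \in p) (in_series T a b).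
Proof.
apply: (iffP hasP) => [[p hp /andP[]]|[p hp [ap bp]]]; first by exists p.
by exists p; rewrite ?ap.
Qed.

Lemma in_seriesC T a b : in_series T a b = in_series T b a.
Proof. by apply: eq_has => p; rewrite andbC. Qed.

Lemma in_series_refl T a : a \in supp T -> in_series T a a.
Proof. by move=> /supp_on_path[p hp ap]; apply/in_seriesP; exists p. Qed.

Lemma subtree_in_series Q T a b :
  linear_tree T -> subtree Q T -> a \in supp Q -> b \in supp Q ->
  in_series T a b = in_series Q a b.
Proof.
move=> l s aQ bQ; apply/in_seriesP/in_seriesP => [[p hp [ap bp]]|[q hq [aq bq]]].
  have [p1 [q [p2 [e hq out _]]]] := subtree_split l s hp ap aQ.
  have inq b' : b' \in p -> b' \in supp Q -> b' \in q.
    rewrite e mem_cat [_ \in q ++ _]mem_cat orbCA => /orP[//|bp12] bQ'.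
    by move: (out b'); rewrite mem_cat bp12 bQ' => /(_ isT).
  by exists q => //; split; exact: inq.
have [p hp ap] := supp_on_path (subsetP (subtree_supp s) a aQ).
have [p1 [_ [p2 [_ _ _ ins]]]] := subtree_split l s hp ap aQ.
by exists (p1 ++ q ++ p2); rewrite ?ins // !mem_cat aq bq !orbT.
Qed.

Lemma in_series_Ser T1 T2 a b :
  a \in supp T1 -> b \in supp T2 -> in_series (Ser T1 T2) a b.
Proof.
move=> /supp_on_path[p hp ap] /supp_on_path[q hq bq].
apply/in_seriesP; exists (p ++ q); first exact: path_Ser_cat.
by rewrite !mem_cat ap bq orbT.
Qed.

Lemma in_series_Par T1 T2 a b : linear_tree (Par T1 T2) ->
  a \in supp T1 -> b \in supp T2 -> in_series (Par T1 T2) a b = false.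
Proof.
move=> /and3P[_ _ d] a1 b2; apply/negP => /in_seriesP[p]; rewrite path_Par.
case/orP=> /path_supp h [/h ha /h hb].
  by rewrite (disjointFr d hb) in b2.
by rewrite (disjointFr d a1) in ha.
Qed.

(** Two arcs in series lie in different factors of some series composition.
    Paths through either one can be exchanged at the node joining these two
    factors, so that one of the new paths collects both arcs; the other one
    still visits the joining node, hence avoids every arc that is parallel to
    both. *)
Lemma series_exchange T k1 k2 p q :
  linear_tree T -> p \in paths T -> q \in paths T -> k1 != k2 ->
  k1 \in p -> k2 \in q -> in_series T k1 k2 ->
  exists r s, [/\ r \in paths T, s \in paths T, perm_eq (r ++ s) (p ++ q),
    k1 \in r /\ k2 \in r
    & forall a, a \in s -> in_series T a k1 || in_series T a k2].
Proof.
elim: T p q => [a|T1 IH1 T2 IH2|T1 IH1 T2 IH2] p q l.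
- by rewrite !inE => /eqP-> /eqP-> ne; rewrite !inE => /eqP k1a /eqP k2a; rewrite k1a k2a eqxx in ne.
- move=> hp0 hq0 ne kp kq ks; have /and3P[l1 l2 d] := l.
  move: hp0 hq0 kp kq.
  move=> /path_SerP[p1 [p2 [h1 h2 ->]]] /path_SerP[q1 [q2 [g1 g2 ->]]].
  rewrite !mem_cat => /orP[k1p|k1p] /orP[k2q|k2q].
  + have s1 := path_supp h1 k1p; have s2 := path_supp g1 k2q.
    have st : subtree T1 (Ser T1 T2) by apply/SubSerL/SubRefl.
    rewrite (subtree_in_series l st s1 s2) in ks.
    have [r [s [hr hs pe [kr1 kr2] av]]] := IH1 _ _ l1 h1 g1 ne k1p k2q ks.
    exists (r ++ p2), (s ++ q2); split; try exact: path_Ser_cat.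
    * apply/permP => P; move/permP/(_ P): pe; rewrite !count_cat => e.
      by rewrite addnACA e addnACA.
    * by rewrite !mem_cat kr1 kr2.
    * move=> a; rewrite mem_cat => /orP[as1|/(path_supp g2) a2].
        have a1 := path_supp hs as1.
        by rewrite !(subtree_in_series l st a1) // av.
      by rewrite in_seriesC in_series_Ser.
  (* The arc k1 comes before k2: exchange at the node joining T1 and T2. *)
  + exists (p1 ++ q2), (q1 ++ p2); split; try exact: path_Ser_cat.
    * by apply/permP => P; rewrite !count_cat; ring.
    * by rewrite !mem_cat k1p k2q orbT.
    * move=> a; rewrite mem_cat => /orP[/(path_supp g1) a1|/(path_supp h2) a2].
        by rewrite (in_series_Ser a1 (path_supp g2 k2q)) orbT.
      by rewrite in_seriesC (in_series_Ser (path_supp h1 k1p) a2).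
  (* The arc k2 comes before k1. *)
  + exists (q1 ++ p2), (p1 ++ q2); split; try exact: path_Ser_cat.
    * by apply/permP => P; rewrite !count_cat; ring.
    * by rewrite !mem_cat k1p k2q orbT.
    * move=> a; rewrite mem_cat => /orP[/(path_supp h1) a1|/(path_supp g2) a2].
        by rewrite (in_series_Ser a1 (path_supp h2 k1p)).
      by rewrite orbC in_seriesC (in_series_Ser (path_supp g1 k2q) a2).
  + have s1 := path_supp h2 k1p; have s2 := path_supp g2 k2q.
    have st : subtree T2 (Ser T1 T2) by apply/SubSerR/SubRefl.
    rewrite (subtree_in_series l st s1 s2) in ks.
    have [r [s [hr hs pe [kr1 kr2] av]]] := IH2 _ _ l2 h2 g2 ne k1p k2q ks.
    exists (p1 ++ r), (q1 ++ s); split; try exact: path_Ser_cat.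
    * apply/permP => P; move/permP/(_ P): pe; rewrite !count_cat => e.
      by rewrite addnACA e addnACA.
    * by rewrite !mem_cat kr1 kr2 !orbT.
    * move=> a; rewrite mem_cat => /orP[/(path_supp g1) a1|as2].
        by rewrite in_series_Ser.
      have a2 := path_supp hs as2.
      by rewrite !(subtree_in_series l st a2) // av.
- move=> hp0 hq0 ne kp kq ks; have /and3P[l1 l2 d] := l.
  move: hp0 hq0; rewrite !path_Par => /orP[h1|h2] /orP[g1|g2].
  + have s1 := path_supp h1 kp; have s2 := path_supp g1 kq.
    have st : subtree T1 (Par T1 T2) by apply/SubParL/SubRefl.
    rewrite (subtree_in_series l st s1 s2) in ks.
    have [r [s [hr hs pe kr av]]] := IH1 _ _ l1 h1 g1 ne kp kq ks.
    exists r, s; rewrite !path_Par hr hs; split=> // a as1.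
    have a1 := path_supp hs as1.
    by rewrite !(subtree_in_series l st a1) // av.
  + by rewrite (in_series_Par l (path_supp h1 kp) (path_supp g2 kq)) in ks.
  + by rewrite in_seriesC (in_series_Par l (path_supp g1 kq) (path_supp h2 kp)) in ks.
  + have s1 := path_supp h2 kp; have s2 := path_supp g2 kq.
    have st : subtree T2 (Par T1 T2) by apply/SubParR/SubRefl.
    rewrite (subtree_in_series l st s1 s2) in ks.
    have [r [s [hr hs pe kr av]]] := IH2 _ _ l2 h2 g2 ne kp kq ks.
    exists r, s; rewrite !path_Par hr hs !orbT; split=> // a as2.
    have a2 := path_supp hs as2.
    by rewrite !(subtree_in_series l st a2) // av.
Qed.

End Trees.

(** * Shortest distances in a tree under attacks *)

Section TreeDistance.
Variables (R : realType) (G : network).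
Implicit Types (T S O Q : sp_tree (arcs G)) (p q P : seq (arcs G)).
Implicit Types (w : arcs G -> R) (x y z : {ffun arcs G -> bool}).

Fixpoint tdist T w : R :=
  match T with
  | Leaf a => w a
  | Ser T1 T2 => tdist T1 w + tdist T2 w
  | Par T1 T2 => Num.min (tdist T1 w) (tdist T2 w)
  end.

Lemma path_length_cat w p q :
  path_length w (p ++ q) = path_length w p + path_length w q.
Proof. exact: big_cat. Qed.

Lemma path_length_eq w w' p :
  (forall a, a \in p -> w a = w' a) -> path_length w p = path_length w' p.
Proof. exact: eq_big_seq. Qed.

Lemma path_length_le w w' p :
  (forall a, a \in p -> w a <= w' a) -> path_length w p <= path_length w' p.
Proof.
by move=> h; rewrite /path_length !big_seq; apply: ler_sum => a /h.
Qed.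

Lemma tdist_le T w p : p \in paths T -> tdist T w <= path_length w p.
Proof.
elim: T p => [a|T1 IH1 T2 IH2|T1 IH1 T2 IH2] p.
- by rewrite inE => /eqP ->; rewrite /path_length big_seq1.
- move=> /path_SerP[p1 [p2 [/IH1 h1 /IH2 h2 ->]]].
  by rewrite path_length_cat lerD.
- by rewrite path_Par ge_min => /orP[/IH1|/IH2] ->; rewrite ?orbT.
Qed.

Lemma tdist_attained T w :
  exists2 p, p \in paths T & path_length w p = tdist T w.
Proof.
elim: T => [a|T1 [p1 h1 e1] T2 [p2 h2 e2]|T1 [p1 h1 e1] T2 [p2 h2 e2]].
- by exists [:: a]; rewrite ?inE // /path_length big_seq1.
- exists (p1 ++ p2); first exact: path_Ser_cat.
  by rewrite path_length_cat e1 e2.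
- have [le12|lt21] := leP (tdist T1 w) (tdist T2 w).
    by exists p1; rewrite ?path_Par ?h1 // e1 /= min_l.
  by exists p2; rewrite ?path_Par ?h2 ?orbT // e2 /= min_r // ltW.
Qed.

Lemma tdist_mono T w w' :
  (forall a, a \in supp T -> w a <= w' a) -> tdist T w <= tdist T w'.
Proof.
move=> h; have [p hp <-] := tdist_attained T w'.
apply: le_trans (tdist_le w hp) _; apply: path_length_le => a ap.
exact/h/(path_supp hp).
Qed.

Variables (c delta : arcs G -> R) (Aa K : {set arcs G}).
Hypothesis delta_att : forall a, a \in Aa -> 0 < delta a.
Hypothesis delta_nonatt : forall a, a \notin Aa -> delta a = 0.

Local Notation len x := (path_length (attacked c delta x)).
Local Notation D T x := (tdist T (attacked c delta x)).

Lemma attacked_eq x y a :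
  (a \in Aa -> x a = y a) -> attacked c delta x a = attacked c delta y a.
Proof.
have [aA /(_ isT) e|aA _] := boolP (a \in Aa); first by rewrite /attacked e.
by rewrite /attacked delta_nonatt // !mul0r.
Qed.

Lemma attacked_le x y a :
  (x a -> y a) -> attacked c delta x a <= attacked c delta y a.
Proof.
have [aA xy|aA _] := boolP (a \in Aa); last first.
  by rewrite (@attacked_eq x y) // (negPf aA).
rewrite lerD2l ler_pM2l ?delta_att // ler_nat.
by case: (x a) xy => // ->.
Qed.

Lemma D_eq T x y :
  (forall a, a \in supp T -> a \in Aa -> x a = y a) -> D T x = D T y.
Proof.
move=> h; apply/le_anti/andP.
by split; apply: tdist_mono => a aT; rewrite (@attacked_eq x y) // => /(h _ aT).
Qed.

Lemma D_le T x y :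
  (forall a, a \in supp T -> x a -> y a) -> D T x <= D T y.
Proof. by move=> h; apply: tdist_mono => a /h; exact: attacked_le. Qed.

Lemma len_eq x y p :
  (forall a, a \in p -> a \in Aa -> x a = y a) -> len x p = len y p.
Proof. by move=> h; apply: path_length_eq => a /h; exact: attacked_eq. Qed.

Lemma len_le x y p : (forall a, a \in p -> x a -> y a) -> len x p <= len y p.
Proof. by move=> h; apply: path_length_le => a /h; exact: attacked_le. Qed.

Lemma len_attack x y k p : uniq p -> k \in p -> x k = false -> y k ->
  (forall a, a \in p -> a != k -> x a = y a) -> len y p = len x p + delta k.
Proof.
move=> up kp xk yk xy.
have e : len y (rem k p) = len x (rem k p).
  apply: path_length_eq => a; rewrite mem_rem_uniq // inE => /andP[ak ap].
  by rewrite /attacked xy.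
rewrite /path_length !(big_rem k kp) /= -!/(path_length _ _) e.
by rewrite {1 3}/attacked xk yk mulr0 mulr1 addr0 addrAC.
Qed.

(** P is the part inside the component T of the shortest path of the network
    without attacks. *)
Definition optimum T P :=
  [/\ P \in paths T, len (no_attack G) P = D T (no_attack G)
    & forall a, a \in supp T -> (a \in K) = (a \in Aa) && (a \in P)].

Definition supermod (f : {ffun arcs G -> bool} -> R) :=
  forall x y, f x + f y <= f (join_attack x y) + f (meet_attack x y).

(** The ({k}|K)-parallel arcs of the component T. *)
Definition parallel_only T k : {set arcs G} :=
  [set a in supp T | ~~ in_series T a k &&
     [forall b in (K :&: supp T) :\ k, in_series T a b]].

(** The path-level content of the joint redundancy of the arcs parallel to a
    pair of arcs of K. *)
Definition pairs_redundant T :=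
  forall k1 k2, k1 \in K :&: supp T -> k2 \in K :&: supp T -> k1 != k2 ->
  forall x, exists p, [/\ p \in paths T, len x p = D T x
    & forall a, a \in p -> in_series T a k1 || in_series T a k2].

(** Q is the component spanned by k and the subnetwork g_k of the theorem: the
    largest component, as far as its parallel arcs are concerned, in which k is
    the only arc of K. The path q makes the terminals of Q incident to g_k. *)
Definition envelope T k Q :=
  [/\ subtree Q T, K :&: supp Q = [set k], parallel_only T k \subset supp Q
    & exists2 q, q \in paths Q & {subset q <= parallel_only T k}].

Definition envelopes_supermod T :=
  forall k Q, envelope T k Q -> forall x y, x k -> y k ->
    D Q x + D Q y <= D Q (join_attack x y) + D Q (meet_attack x y).

(** As long as the arcs of K are spared, the unattacked shortest path keeps its
    length and attacks elsewhere cannot produce anything shorter. *)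
Lemma spared_distance T P x : optimum T P ->
  (forall a, a \in supp T -> a \in K -> x a = false) ->
  D T x = D T (no_attack G).
Proof.
move=> [hP eP KP] xK; apply/le_anti/andP; split; last first.
  by apply: D_le => a _; rewrite ffunE.
rewrite -eP; apply: le_trans (tdist_le _ hP) _.
rewrite (@len_eq x (no_attack G)) // => a aP aA; rewrite ffunE.
have aT := path_supp hP aP.
by apply: xK; rewrite // KP // aA.
Qed.

Lemma optimum_Ser T1 T2 P : linear_tree (Ser T1 T2) -> optimum (Ser T1 T2) P ->
  exists p1 p2, [/\ P = p1 ++ p2, optimum T1 p1 & optimum T2 p2].
Proof.
move=> /and3P[_ _ d] [/path_SerP[p1 [p2 [h1 h2 ->]]]].
rewrite path_length_cat /= => e KP; exists p1, p2.
have le1 := tdist_le (attacked c delta (no_attack G)) h1.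
have le2 := tdist_le (attacked c delta (no_attack G)) h2.
split=> //; split=> //; try lra.
  move=> a a1; rewrite KP ?inE ?a1 // mem_cat.
  suff /negPf -> : a \notin p2 by rewrite orbF.
  by apply: contraL (a1) => /(path_supp h2) a2; rewrite (disjointFl d a2).
move=> a a2; rewrite KP ?inE ?a2 ?orbT // mem_cat.
suff /negPf -> : a \notin p1 by [].
by apply: contraL (a2) => /(path_supp h1) a1; rewrite (disjointFr d a1).
Qed.

(** The unattacked shortest path runs on one side of a parallel composition. S
    stands for that side and O for the other one, whichever comes first. *)
Definition parallel_sides T S O :=
  [/\ forall p, (p \in paths T) = (p \in paths S) || (p \in paths O),
      forall w, tdist T w = Num.min (tdist S w) (tdist O w),
      supp T = supp S :|: supp O, subtree S T
    & forall a b, a \in supp S -> b \in supp O -> in_series T a b = false].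

Lemma optimum_Par T1 T2 P : linear_tree (Par T1 T2) -> optimum (Par T1 T2) P ->
  exists S O, [/\ parallel_sides (Par T1 T2) S O, S = T1 \/ S = T2, optimum S P
    & [disjoint K & supp O]].
Proof.
move=> l [hP eP KP]; have /and3P[_ _ d] := l.
move: hP; rewrite path_Par => /orP[h1|h2].
  exists T1, T2; split; first split=> //.
  - by move=> p; rewrite path_Par.
  - exact/SubParL/SubRefl.
  - by move=> a b a1 b2; rewrite in_series_Par.
  - by left.
  - split=> //; last by move=> a a1; rewrite KP // inE a1.
    apply/le_anti; rewrite {1}eP /= ge_min lexx /=.
    exact: tdist_le.
  - apply/pred0P => a /=; apply/negP => /andP[aK a2].
    move: aK; rewrite KP ?inE ?a2 ?orbT // => /andP[_ /(path_supp h1)].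
    by rewrite (disjointFl d a2).
exists T2, T1; split; first split=> //.
- by move=> p; rewrite path_Par orbC.
- by move=> w /=; rewrite minC.
- by rewrite /= setUC.
- exact/SubParR/SubRefl.
- by move=> a b a1 b2; rewrite in_seriesC in_series_Par.
- by right.
- split=> //; last by move=> a a2; rewrite KP // inE a2 orbT.
  apply/le_anti; rewrite {1}eP /= ge_min lexx orbT /=.
  exact: tdist_le.
- apply/pred0P => a /=; apply/negP => /andP[aK a1].
  move: aK; rewrite KP ?inE ?a1 // => /andP[_ /(path_supp h2)].
  by rewrite (disjointFr d a1).
Qed.

Lemma optimum_subtree T P Q k : linear_tree T -> optimum T P -> subtree Q T ->
  k \in K -> k \in supp Q ->
  exists p1 q p2, [/\ P = p1 ++ q ++ p2, optimum Q q,
    forall b, b \in p1 ++ p2 -> b \notin supp Q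
    & forall q', q' \in paths Q -> p1 ++ q' ++ p2 \in paths T].
Proof.
move=> l [hP eP KP] s kK kQ.
have kP : k \in P by move: kK; rewrite KP ?(subsetP (subtree_supp s)) // => /andP[].
have [p1 [q [p2 [e hq out ins]]]] := subtree_split l s hP kP kQ.
exists p1, q, p2; split=> //; split=> //.
  apply/le_anti/andP; split; last exact: tdist_le.
  have [q' hq' <-] := tdist_attained Q (attacked c delta (no_attack G)).
  have := tdist_le (attacked c delta (no_attack G)) (ins _ hq').
  rewrite -eP e !path_length_cat; lra.
move=> a aQ; rewrite KP ?(subsetP (subtree_supp s)) // e; congr (_ && _).
rewrite mem_cat [_ \in q ++ _]mem_cat orbCA.
by case: (a \in q) => //=; apply: contraTF aQ => h; apply: out; rewrite mem_cat.
Qed.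

Lemma subtree_trans T S Q : subtree Q S -> subtree S T -> subtree Q T.
Proof. by move=> qs; elim=> *; [| constructor..]. Qed.

(** Passing to a component that contains k changes nothing if it loses only
    arcs of K in series with the rest and arcs that are not parallel to k
    alone. *)
Lemma parallel_only_subtree T S k : linear_tree T -> subtree S T ->
  k \in supp S ->
  (forall a b, a \in supp S -> b \in K -> b \in supp T -> b \notin supp S ->
    in_series T a b) ->
  (forall a, a \in supp T -> a \notin supp S -> in_series T a k \/
    exists2 b, b \in (K :&: supp T) :\ k & ~~ in_series T a b) ->
  parallel_only T k = parallel_only S k.
Proof.
move=> l s kS hb ha; apply/setP => a; rewrite !inE.
have sT := subsetP (subtree_supp s).
have [aS|aS] := boolP (a \in supp S); last first.
  apply/negP => /and3P[aT nk /forall_inP hK]; case: (ha _ aT aS) => [h|[b bK h]].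
    by rewrite h in nk.
  by move: h; rewrite hK.
rewrite sT //= (subtree_in_series l s) //; congr (_ && _).
apply/forall_inP/forall_inP => h b; rewrite !inE.
  move=> /and3P[bk bK bS]; rewrite -(subtree_in_series l s) //.
  by apply: h; rewrite !inE bk bK sT.
move=> /and3P[bk bK bT]; have [bS|bS] := boolP (b \in supp S).
  by rewrite (subtree_in_series l s) // h // !inE bk bK bS.
exact: hb.
Qed.

Lemma parallel_only_SerL T1 T2 k : linear_tree (Ser T1 T2) -> k \in supp T1 ->
  parallel_only (Ser T1 T2) k = parallel_only T1 k.
Proof.
move=> l k1; apply: parallel_only_subtree => //; first exact/SubSerL/SubRefl.
  by move=> a b a1 _ /setUP[->|b2] // _; exact: in_series_Ser.
move=> a /setUP[->|a2] // _; left.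
by rewrite in_seriesC in_series_Ser.
Qed.

Lemma parallel_only_SerR T1 T2 k : linear_tree (Ser T1 T2) -> k \in supp T2 ->
  parallel_only (Ser T1 T2) k = parallel_only T2 k.
Proof.
move=> l k2; apply: parallel_only_subtree => //; first exact/SubSerR/SubRefl.
  by move=> a b a1 _ /setUP[b1|->] // _; rewrite in_seriesC in_series_Ser.
by move=> a /setUP[a1|->] // _; left; rewrite in_series_Ser.
Qed.

Lemma parallel_only_side T S O k k' : linear_tree T -> parallel_sides T S O ->
  [disjoint K & supp O] -> k \in supp S -> k' \in K :&: supp S -> k' != k ->
  parallel_only T k = parallel_only S k.
Proof.
move=> l [_ _ eT s x0] dK kS /setIP[k'K k'S] kk'.
apply: parallel_only_subtree => //.
  move=> a b _ bK; rewrite eT => /setUP[->//|bO].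
  by rewrite (disjointFr dK bK) in bO.
move=> a; rewrite eT => /setUP[->//|aO] _; right; exists k'.
  by rewrite !inE kk' k'K k'S.
by rewrite in_seriesC x0.
Qed.

Lemma envelope_lift T S k Q : parallel_only T k = parallel_only S k ->
  subtree S T -> envelope S k Q -> envelope T k Q.
Proof.
by move=> e s [h1 h2 h3 h4]; split; rewrite ?e //; exact: subtree_trans h1 s.
Qed.

Lemma envelope_in T k Q : envelope T k Q -> k \in K /\ k \in supp Q.
Proof.
by move=> [_ /setP/(_ k) + _ _]; rewrite !inE eqxx => /andP[].
Qed.

(** The arcs on the side that K misses are all parallel to k. *)
Lemma envelope_self T S O k : parallel_sides T S O -> [disjoint K & supp O] ->
  K :&: supp S = [set k] -> envelope T k T.
Proof.
move=> [eP _ eT _ x0] dK eK.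
have KT : K :&: supp T = [set k].
  apply/setP => a; rewrite -eK eT !inE.
  by have [aK|//] := boolP (a \in K); rewrite (disjointFr dK aK) orbF.
have /setIP[kK kS] : k \in K :&: supp S by rewrite eK inE.
split=> //; first exact: SubRefl.
  by apply/subsetP => a; rewrite inE => /andP[].
have [q hq] := path_exists O; exists q; first by rewrite eP hq orbT.
move=> a /(path_supp hq) aO; rewrite !inE eT inE aO orbT /= in_seriesC x0 //=.
by apply/forall_inP => b; rewrite -eT KT !inE => /andP[/negPf ->].
Qed.

Lemma pairs_redundant_Ser T1 T2 : linear_tree (Ser T1 T2) ->
  pairs_redundant (Ser T1 T2) -> pairs_redundant T1 /\ pairs_redundant T2.
Proof.
move=> l h.
have s1 : subtree T1 (Ser T1 T2) by exact/SubSerL/SubRefl.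
have s2 : subtree T2 (Ser T1 T2) by exact/SubSerR/SubRefl.
split=> k1 k2 /setIP[k1K k1T] /setIP[k2K k2T] ne x;
  have [||_ [/path_SerP[p1 [p2 [h1 h2 ->]]]]] := h k1 k2 _ _ ne x;
  rewrite ?inE ?k1K ?k2K ?k1T ?k2T ?orbT //;
  rewrite path_length_cat /= => e av;
  have le1 := tdist_le (attacked c delta x) h1;
  have le2 := tdist_le (attacked c delta x) h2.
- exists p1; split=> //; first lra.
  move=> a ap; rewrite -!(subtree_in_series l s1) ?(path_supp h1 ap) //.
  by apply: av; rewrite mem_cat ap.
- exists p2; split=> //; first lra.
  move=> a ap; rewrite -!(subtree_in_series l s2) ?(path_supp h2 ap) //.
  by apply: av; rewrite mem_cat ap orbT.
Qed.

(** The arcs of the side O are parallel to all the arcs of K in S, so if there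
    are two of these then O never matters. *)
Lemma pairs_redundant_side T S O k1 k2 : linear_tree T -> parallel_sides T S O ->
  pairs_redundant T -> k1 \in K :&: supp S -> k2 \in K :&: supp S -> k1 != k2 ->
  (forall x, D T x = D S x) /\ pairs_redundant S.
Proof.
move=> l [eP eD eT s x0] h.
have main k k' x : k \in K :&: supp S -> k' \in K :&: supp S -> k != k' ->
    D T x = D S x /\ exists p, [/\ p \in paths S, len x p = D S x
      & forall a, a \in p -> in_series S a k || in_series S a k'].
  move=> /setIP[kK kS] /setIP[k'K k'S] ne.
  have [||p [hp e av]] := h k k' _ _ ne x; rewrite ?inE ?eT ?inE ?kK ?k'K ?kS ?k'S //.
  have hpS : p \in paths S.
    move: hp; rewrite eP => /orP[//|hO].
    case: p hO (path_nonempty hO) av {e} => // a p hO _ /(_ a).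
    have aO : a \in supp O by apply: (path_supp hO); rewrite inE eqxx.
    by rewrite inE eqxx !(in_seriesC T a) !x0 // => /(_ isT).
  have eS : D T x = D S x.
    apply/le_anti; rewrite {1}eD ge_min lexx /= -e.
    exact: tdist_le.
  split=> //; exists p; split; rewrite -?eS //.
  move=> a ap; rewrite -!(subtree_in_series l s) ?(path_supp hpS ap) //.
  exact: av.
move=> k1S k2S ne; split=> [x|k k' kS k'S ne' x].
  by have [] := main k1 k2 x k1S k2S ne.
by have [] := main k k' x kS k'S ne'.
Qed.

(** In a component whose only arc of K is k, the arcs in series with k matter
    only through components that the unattacked shortest path crosses along
    non-attackable arcs; their distance is constant. *)
Lemma parallel_arcs_determine T P k x y : linear_tree T -> optimum T P ->
  K :&: supp T = [set k] ->
  (forall a, a \in supp T -> a \in Aa -> (a == k) || ~~ in_series T a k ->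
    x a = y a) ->
  D T x = D T y.
Proof.
elim: T P => [a|T1 IH1 T2 IH2|T1 IH1 T2 IH2] P l hP eK h.
- apply: D_eq => b /[dup] bT /set1P e bA; apply: h => //.
  have : k \in K :&: supp (Leaf a) by rewrite eK inE.
  by rewrite inE => /andP[_ /set1P ->]; rewrite e eqxx.
- have [p1 [p2 [_ o1 o2]]] := optimum_Ser l hP.
  have /and3P[l1 l2 d] := l.
  have : k \in K :&: supp (Ser T1 T2) by rewrite eK inE.
  case/setIP=> kK /setUP[k1|k2] /=.
    have eK1 : K :&: supp T1 = [set k].
      apply/setP => a; rewrite -eK !inE; case: (boolP (a \in supp T2)) => [a2|].
        rewrite orbT andbT (disjointFl d a2) andbF; apply/esym/negP => aK.
        have : a \in K :&: supp (Ser T1 T2) by rewrite !inE aK a2 orbT.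
        by rewrite eK => /set1P ak; rewrite ak (disjointFr d k1) in a2.
      by rewrite orbF.
    have spare z : D T2 z = D T2 (no_attack G).
      apply: spared_distance o2 _ => a a2 aK.
      have : a \in K :&: supp (Ser T1 T2) by rewrite !inE aK a2 orbT.
      by rewrite eK => /set1P ak; rewrite ak (disjointFr d k1) in a2.
    rewrite !spare; congr (_ + _); apply: IH1 o1 eK1 _ => // a a1 aA ha.
    apply: h; rewrite ?inE ?a1 // (@subtree_in_series _ T1) //.
    exact/SubSerL/SubRefl.
  have eK2 : K :&: supp T2 = [set k].
    apply/setP => a; rewrite -eK !inE; case: (boolP (a \in supp T1)) => [a1|].
      rewrite andbT (disjointFr d a1) andbF; apply/esym/negP => aK.
      have : a \in K :&: supp (Ser T1 T2) by rewrite !inE aK a1.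
      by rewrite eK => /set1P ak; rewrite ak (disjointFl d k2) in a1.
    by [].
  have spare z : D T1 z = D T1 (no_attack G).
    apply: spared_distance o1 _ => a a1 aK.
    have : a \in K :&: supp (Ser T1 T2) by rewrite !inE aK a1.
    by rewrite eK => /set1P ak; rewrite ak (disjointFl d k2) in a1.
  rewrite !spare; congr (_ + _); apply: IH2 o2 eK2 _ => // a a2 aA ha.
  apply: h; rewrite ?inE ?a2 ?orbT // (@subtree_in_series _ T2) //.
  exact/SubSerR/SubRefl.
- have [S [O [[eP eD eT s x0] hS oS dK]]] := optimum_Par l hP.
  have eKS : K :&: supp S = [set k].
    apply/setP => a; rewrite -eK eT !inE.
    by have [aK|//] := boolP (a \in K); rewrite (disjointFr dK aK) orbF.
  have /setIP[kK kS] : k \in K :&: supp S by rewrite eKS inE.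
  rewrite !eD; congr Num.min; last first.
    apply: D_eq => a aO aA; apply: h => //; first by rewrite eT inE aO orbT.
    by rewrite in_seriesC x0 // orbT.
  have /and3P[l1 l2 _] := l.
  have hS' a : a \in supp S -> a \in Aa -> (a == k) || ~~ in_series S a k -> x a = y a.
    move=> aS aA ha; apply: h => //; first by rewrite eT inE aS.
    by rewrite (subtree_in_series l s).
  by case: hS oS eKS hS' => ->; [apply: (IH1 P l1)|apply: (IH2 P l2)].
Qed.

(** * Sufficiency of the two conditions *)

(** When k is spared the distance is constant, and otherwise it is larger, so
    supermodularity need only be checked under attacks of k. *)
Lemma supermod_of_attacked T P k : optimum T P -> K :&: supp T = [set k] ->
  (forall x y, x k -> y k ->
    D T x + D T y <= D T (join_attack x y) + D T (meet_attack x y)) ->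
  supermod (fun x => D T x).
Proof.
move=> o eK h.
have spare z : z k = false -> D T z = D T (no_attack G).
  move=> zk; apply: spared_distance o _ => a aT aK.
  have : a \in K :&: supp T by rewrite inE aK.
  by rewrite eK => /set1P ->.
move=> x y; case xk: (x k); case yk: (y k); first exact: h.
- rewrite addrC (spare y) // (spare (meet_attack x y)) ?ffunE ?xk ?yk //.
  by rewrite [leRHS]addrC lerD2l; apply: D_le => a _; rewrite ffunE => ->.
- rewrite (spare x) // (spare (meet_attack x y)) ?ffunE ?xk ?yk //.
  rewrite [leRHS]addrC lerD2l; apply: D_le => a _; rewrite ffunE => ->.
  by rewrite orbT.
- by rewrite !spare // ffunE ?xk ?yk.
Qed.

Lemma K_cases T : [\/ K :&: supp T = set0, exists k, K :&: supp T = [set k]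
  | exists k1 k2, [/\ k1 \in K :&: supp T, k2 \in K :&: supp T & k1 != k2]].
Proof.
have [->|[k1 h1]] := set_0Vmem (K :&: supp T); first exact: Or31.
have [e|[k2]] := set_0Vmem ((K :&: supp T) :\ k1).
  by apply: Or32; exists k1; rewrite -(setD1K h1) e setU0.
by move=> /setD1P[ne h2]; apply: Or33; exists k1, k2; rewrite eq_sym.
Qed.

(** At a series composition distances add up. A parallel composition that K
    meets once is the envelope of the arc in question, and one that K meets
    more often has the distance of the side that contains K. *)
Lemma supermod_of_conditions T P : linear_tree T -> optimum T P ->
  pairs_redundant T -> envelopes_supermod T -> supermod (fun x => D T x).
Proof.
elim: T P => [a|T1 IH1 T2 IH2|T1 IH1 T2 IH2] P l hP h1 h2.
- move=> x y /=; rewrite /attacked !ffunE.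
  by case: (x a); case: (y a) => /=; lra.
- have [p1 [p2 [_ o1 o2]]] := optimum_Ser l hP.
  have /and3P[l1 l2 d] := l.
  have [r1 r2] := pairs_redundant_Ser l h1.
  have e1 : envelopes_supermod T1.
    move=> k Q tQ; apply: (h2 k).
    apply: (envelope_lift _ _ tQ); last exact/SubSerL/SubRefl.
    apply: parallel_only_SerL => //; have [_ kQ] := envelope_in tQ.
    by case: tQ => /subtree_supp/subsetP + _ _ _; apply.
  have e2 : envelopes_supermod T2.
    move=> k Q tQ; apply: (h2 k).
    apply: (envelope_lift _ _ tQ); last exact/SubSerR/SubRefl.
    apply: parallel_only_SerR => //; have [_ kQ] := envelope_in tQ.
    by case: tQ => /subtree_supp/subsetP + _ _ _; apply.
  move=> x y; have := IH1 _ l1 o1 r1 e1 x y; have := IH2 _ l2 o2 r2 e2 x y.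
  by move=> /=; lra.
- have [S [O [sides hS oS dK]]] := optimum_Par l hP.
  have [eP eD eT s x0] := sides.
  have KS a : (a \in K :&: supp (Par T1 T2)) = (a \in K :&: supp S).
    rewrite eT !inE.
    by have [aK|//] := boolP (a \in K); rewrite (disjointFr dK aK) orbF.
  case: (K_cases S) => [e|[k eK]|[k1 [k2 [k1S k2S ne]]]].
  + have spare z : D (Par T1 T2) z = D (Par T1 T2) (no_attack G).
      apply: spared_distance hP _ => a aT aK.
      by have := KS a; rewrite e !in_set0 in_setI aK aT.
    by move=> x y; rewrite (spare x) (spare y) (spare (join_attack _ _)) spare.
  + have env := envelope_self sides dK eK.
    apply: supermod_of_attacked hP _ (h2 _ _ env).
    by apply/setP => a; rewrite KS eK.
  + have [eDS rS] := pairs_redundant_side l sides h1 k1S k2S ne.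
    have eS : envelopes_supermod S.
      move=> k Q tQ; apply: (h2 k); apply: (envelope_lift _ _ tQ) => //.
      have [kK kQ] := envelope_in tQ.
      have kS : k \in supp S by case: tQ => /subtree_supp/subsetP + _ _ _; apply.
      have [e|ne'] := eqVneq k1 k.
        by apply: (parallel_only_side l sides dK kS k2S); rewrite -e eq_sym.
      exact: (parallel_only_side l sides dK kS k1S).
    have /and3P[l1 l2 _] := l.
    suff SS : supermod (fun x => D S x).
      by move=> x y; have := SS x y; rewrite -!eDS.
    by case: hS oS rS eS => ->; [apply: (IH1 P l1)|apply: (IH2 P l2)].
Qed.

(** * Necessity of the two conditions *)

(** Keep the attacks on the other factor fixed. *)
Lemma supermod_Ser T1 T2 : linear_tree (Ser T1 T2) ->
  supermod (fun x => D (Ser T1 T2) x) ->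
  supermod (fun x => D T1 x) /\ supermod (fun x => D T2 x).
Proof.
move=> /and3P[_ _ d] h; split=> x y.
  pose r z := override (supp T1) z (no_attack G).
  have e1 z : D T1 (r z) = D T1 z by apply: D_eq => a a1 _; rewrite ffunE a1.
  have e2 z : D T2 (r z) = D T2 (no_attack G).
    by apply: D_eq => a a2 _; rewrite ffunE (disjointFl d a2).
  have ej : join_attack (r x) (r y) = r (join_attack x y).
    by apply/ffunP => a; rewrite !ffunE; case: ifP.
  have em : meet_attack (r x) (r y) = r (meet_attack x y).
    by apply/ffunP => a; rewrite !ffunE; case: ifP.
  by have := h (r x) (r y); rewrite ej em /= !e1 !e2; lra.
pose r z := override (supp T2) z (no_attack G).
have e2 z : D T2 (r z) = D T2 z by apply: D_eq => a a2 _; rewrite ffunE a2.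
have e1 z : D T1 (r z) = D T1 (no_attack G).
  by apply: D_eq => a a1 _; rewrite ffunE (disjointFr d a1).
have ej : join_attack (r x) (r y) = r (join_attack x y).
  by apply/ffunP => a; rewrite !ffunE; case: ifP.
have em : meet_attack (r x) (r y) = r (meet_attack x y).
  by apply/ffunP => a; rewrite !ffunE; case: ifP.
by have := h (r x) (r y); rewrite ej em /= !e1 !e2; lra.
Qed.

(** Descend towards k. The distance of the component stays supermodular on the
    way, because at a parallel composition with a second arc of K the side
    without K is irrelevant; the descent ends where k becomes the only arc of
    K. *)
Lemma envelope_exists T P k : linear_tree T -> optimum T P ->
  pairs_redundant T -> supermod (fun x => D T x) -> k \in K :&: supp T ->
  parallel_only T k != set0 ->
  exists2 Q, envelope T k Q & supermod (fun x => D Q x).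
Proof.
elim: T P => [a|T1 IH1 T2 IH2|T1 IH1 T2 IH2] P l hP r sm /setIP[kK kT] ne.
- case/negP: ne; apply/eqP/setP => b; rewrite !inE.
  apply/negP => /and3P[/eqP e ns _]; case/negP: ns.
  by move: kT => /set1P ->; rewrite e in_series_refl // inE.
- have [p1 [p2 [_ o1 o2]]] := optimum_Ser l hP.
  have /and3P[l1 l2 d] := l.
  have [r1 r2] := pairs_redundant_Ser l r.
  have [sm1 sm2] := supermod_Ser l sm.
  move: kT => /setUP[kT|kT].
    have e := parallel_only_SerL l kT.
    have [||Q tQ sQ] := IH1 _ l1 o1 r1 sm1; rewrite ?inE ?kK -?e //.
    by exists Q => //; apply: envelope_lift tQ => //; exact/SubSerL/SubRefl.
  have e := parallel_only_SerR l kT.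
  have [||Q tQ sQ] := IH2 _ l2 o2 r2 sm2; rewrite ?inE ?kK -?e //.
  by exists Q => //; apply: envelope_lift tQ => //; exact/SubSerR/SubRefl.
- have [S [O [sides hS oS dK]]] := optimum_Par l hP.
  have [eP eD eT s x0] := sides.
  have kS : k \in supp S.
    by move: kT; rewrite eT => /setUP[//|kO]; rewrite (disjointFr dK kK) in kO.
  have [e|[k2]] := set_0Vmem ((K :&: supp S) :\ k).
    have eK : K :&: supp S = [set k] by rewrite -(@setD1K _ k (_ :&: _)) ?e ?setU0 // inE kK.
    by exists (Par T1 T2) => //; apply: envelope_self sides dK eK.
  move=> /setD1P[ne2 k2S].
  have kS' : k \in K :&: supp S by rewrite inE kK.
  have [eDS rS] := pairs_redundant_side l sides r k2S kS' ne2.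
  have e := parallel_only_side l sides dK kS k2S ne2.
  have smS : supermod (fun x => D S x) by move=> x y; rewrite -!eDS.
  have /and3P[l1 l2 _] := l.
  suff [Q tQ sQ] : exists2 Q, envelope S k Q & supermod (fun x => D Q x).
    by exists Q => //; apply: envelope_lift tQ.
  rewrite e in ne.
  by case: hS oS rS smS kS' ne => ->; [apply: (IH1 P l1)|apply: (IH2 P l2)].
Qed.

(** When k2 is attacked and k1 is not, every shortest path must pass through
    k1: by supermodularity the effect of attacking k1 is at least its effect in
    the absence of other attacks, which is positive. Likewise for k2.
    Exchanging two such paths yields one that collects both arcs and one that
    avoids their common parallel arcs; supermodularity bounds the length of the
    latter. *)
Lemma supermod_pairs_redundant T P : linear_tree T -> optimum T P ->
  (forall p, p \in paths T -> p != P ->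
    D T (no_attack G) < len (no_attack G) p) ->
  supermod (fun x => D T x) -> pairs_redundant T.
Proof.
move=> l [hP eP KP] strict sm k1 k2 /setIP[k1K k1T] /setIP[k2K k2T] ne x.
have Katt k : k \in K -> k \in supp T -> k \in Aa /\ k \in P.
  by move=> + kT; rewrite KP // => /andP.
have [k1A k1P] := Katt _ k1K k1T; have [k2A k2P] := Katt _ k2K k2T.
pose X : {ffun arcs G -> bool} := [ffun a => [|| x a, a == k1 | a == k2]].
pose spare k : {ffun arcs G -> bool} := [ffun a => X a && (a != k)].
have through k p : k \in K -> k \in supp T -> X k -> p \in paths T ->
    len (spare k) p = D T (spare k) -> k \in p.
  move=> kK kT Xk hp ep; have [kA kP] := Katt _ kK kT.
  apply/negPn/negP => kp.
  pose y : {ffun arcs G -> bool} := [ffun a => a == k].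
  have y0 : D T (no_attack G) < D T y.
    have [q hq <-] := tdist_attained T (attacked c delta y).
    have q0 : D T (no_attack G) <= len (no_attack G) q by exact: tdist_le.
    have [e|/(strict _ hq) lt] := eqVneq q P; last first.
      apply: lt_le_trans lt _; apply: len_le => a _.
      by rewrite ffunE.
    rewrite (@len_attack (no_attack G) y k) ?(path_uniq l hq) ?e ?ffunE ?eqxx //.
      by move: q0 (delta_att kA); rewrite e; lra.
    by move=> a _ /negPf ak; rewrite !ffunE ak.
  have := sm y (spare k).
  have -> : join_attack y (spare k) = X.
    apply/ffunP => a; rewrite !ffunE; case: eqVneq => [->|_] /=.
      by move: Xk; rewrite ffunE.
    by rewrite andbT.
  have -> : meet_attack y (spare k) = no_attack G.
    by apply/ffunP => a; rewrite !ffunE; case: eqVneq; rewrite ?andbF.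
  have : D T X <= D T (spare k).
    rewrite -ep; apply: le_trans (tdist_le _ hp) _; apply: len_le => a ap.
    rewrite [spare k a]ffunE => ->; apply: contraNneq kp => <- //.
  by move: y0; lra.
have Xk1 : X k1 by rewrite ffunE eqxx orbT.
have Xk2 : X k2 by rewrite ffunE eqxx !orbT.
have [p hp ep] := tdist_attained T (attacked c delta (spare k1)).
have [q hq eq] := tdist_attained T (attacked c delta (spare k2)).
have k1p := through _ _ k1K k1T Xk1 hp ep.
have k2q := through _ _ k2K k2T Xk2 hq eq.
have ks : in_series T k1 k2 by apply/in_seriesP; exists P.
have [r [s [hr hs pe [k1r k2r] av]]] := series_exchange l hp hq ne k1p k2q ks.
have eX k u : k \in u -> u \in paths T -> X k -> len X u = len (spare k) u + delta k.
  move=> ku hu Xk; apply: len_attack => //; first exact: (path_uniq l hu).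
    by rewrite [spare k k]ffunE eqxx andbF.
  by move=> a _ ak; rewrite [spare k a]ffunE ak andbT.
(* The supermodular inequality is that of the attacks X without k1 and X
   without k2; their join is X. *)
pose Y := meet_attack (spare k1) (spare k2).
have eY : len (spare k1) r = len Y r + delta k2.
  apply: len_attack => //; first exact: (path_uniq l hr).
  - by rewrite ffunE ![spare _ _]ffunE eqxx !andbF.
  - by rewrite ffunE Xk2 eq_sym.
  - by move=> a _ ak; rewrite /Y /meet_attack !ffunE ak andbT andbAC andbb.
have es : len X r + len X s = len X p + len X q.
  by rewrite -!path_length_cat; exact: perm_big.
have sX : len X s <= D T X.
  have := sm (spare k1) (spare k2).
  have -> : join_attack (spare k1) (spare k2) = X.
    apply/ffunP => a; rewrite /join_attack ffunE ![spare _ _]ffunE -andb_orr.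
    have [->|_] := eqVneq a k1; last by rewrite andbT.
    by rewrite ne andbT.
  have := tdist_le (attacked c delta Y) hr.
  move: es; rewrite (eX k1 r) // (eX k1 p) // (eX k2 q) // eY ep eq.
  by rewrite -/Y; lra.
(* If a shortest path p0 under x uses a common parallel arc, it contains
   neither k1 nor k2, so that it is no shorter under x than under X. *)
have [p0 hp0 e0] := tdist_attained T (attacked c delta x).
have [/allP av0|/allPn[a ap]] :=
  boolP (all (fun a => in_series T a k1 || in_series T a k2) p0).
  by exists p0.
rewrite negb_or => /andP[na1 na2]; exists s; split=> //.
have k1p0 : k1 \notin p0 by apply: contra na1 => h; apply/in_seriesP; exists p0.
have k2p0 : k2 \notin p0 by apply: contra na2 => h; apply/in_seriesP; exists p0.
apply/le_anti/andP; split; last exact: tdist_le.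
have xX : len x s <= len X s by apply: len_le => b _; rewrite ffunE => ->.
apply: le_trans xX _; apply: le_trans sX _.
rewrite -e0 -(@len_eq X x p0); first exact: tdist_le.
move=> b bp _; rewrite ffunE.
have [bk|_] := eqVneq b k1; first by rewrite -bk bp in k1p0.
by have [bk|_] := eqVneq b k2; [rewrite -bk bp in k2p0 | rewrite !orbF].
Qed.

(** * Submodularity for attacks along one path *)

(** Truncation at M preserves the submodular inequality between the values j
    at the join, m at the meet, and a and b, thanks to monotonicity. *)
Lemma min_submod (j m a b M : R) : m <= a -> m <= b -> a <= j -> b <= j ->
  j + m <= a + b ->
  Num.min j M + Num.min m M <= Num.min a M + Num.min b M.
Proof.
move=> ma mb aj bj h.
by case: (leP j M) => ?; case: (leP m M) => ?; case: (leP a M) => ?;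
  case: (leP b M) => ?; lra.
Qed.

(** Components that the path misses have a constant distance, which truncates
    the distance of the components parallel to them. *)
Lemma submod_along_path T P x y : linear_tree T -> P \in paths T ->
  (forall a, a \in supp T -> x a -> a \in P) ->
  (forall a, a \in supp T -> y a -> a \in P) ->
  D T (join_attack x y) + D T (meet_attack x y) <= D T x + D T y.
Proof.
elim: T P => [a|T1 IH1 T2 IH2|T1 IH1 T2 IH2] P l.
- move=> _ _ _ /=; rewrite /attacked !ffunE.
  by case: (x a); case: (y a) => /=; lra.
- move=> /path_SerP[p1 [p2 [h1 h2 ->]]] hx hy; have /and3P[l1 l2 d] := l.
  have r1 (z : {ffun arcs G -> bool}) :
      (forall a, a \in supp (Ser T1 T2) -> z a -> a \in p1 ++ p2) ->
      forall a, a \in supp T1 -> z a -> a \in p1.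
    move=> hz a a1 za; have := hz a; rewrite !inE a1 mem_cat za => /(_ isT isT).
    by case/orP=> // /(path_supp h2); rewrite (disjointFr d a1).
  have r2 (z : {ffun arcs G -> bool}) :
      (forall a, a \in supp (Ser T1 T2) -> z a -> a \in p1 ++ p2) ->
      forall a, a \in supp T2 -> z a -> a \in p2.
    move=> hz a a2 za; have := hz a; rewrite !inE a2 orbT mem_cat za => /(_ isT isT).
    by case/orP=> // /(path_supp h1); rewrite (disjointFl d a2).
  have := IH1 _ l1 h1 (r1 _ hx) (r1 _ hy).
  by have := IH2 _ l2 h2 (r2 _ hx) (r2 _ hy); move=> /=; lra.
- have /and3P[l1 l2 d] := l.
  have truncate S O : [disjoint supp S & supp O] -> P \in paths S ->
      supp S \subset supp (Par T1 T2) -> supp O \subset supp (Par T1 T2) ->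
      (forall a, a \in supp (Par T1 T2) -> x a -> a \in P) ->
      (forall a, a \in supp (Par T1 T2) -> y a -> a \in P) ->
      ((forall a, a \in supp S -> x a -> a \in P) ->
       (forall a, a \in supp S -> y a -> a \in P) ->
       D S (join_attack x y) + D S (meet_attack x y) <= D S x + D S y) ->
      Num.min (D S (join_attack x y)) (D O (join_attack x y)) +
      Num.min (D S (meet_attack x y)) (D O (meet_attack x y)) <=
      Num.min (D S x) (D O x) + Num.min (D S y) (D O y).
    move=> dSO hP /subsetP sS /subsetP sO hx hy IH.
    have hxS a (aS : a \in supp S) := hx _ (sS _ aS).
    have hyS a (aS : a \in supp S) := hy _ (sS _ aS).
    have out (z : {ffun arcs G -> bool}) :
        (forall a, a \in supp (Par T1 T2) -> z a -> a \in P) ->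
        D O z = D O (no_attack G).
      move=> hz; apply: D_eq => a aO _; rewrite ffunE; apply/negP => za.
      by have /(path_supp hP) := hz _ (sO _ aO) za; rewrite (disjointFl dSO aO).
    rewrite (out (join_attack x y)); last first.
      by move=> a aT; rewrite ffunE => /orP[/(hx _ aT)|/(hy _ aT)].
    rewrite (out (meet_attack x y)); last first.
      by move=> a aT; rewrite ffunE => /andP[/(hx _ aT)].
    rewrite (out x hx) (out y hy).
    have := IH hxS hyS.
    have : D S (meet_attack x y) <= D S x.
      by apply: D_le => a _; rewrite ffunE => /andP[].
    have : D S (meet_attack x y) <= D S y.
      by apply: D_le => a _; rewrite ffunE => /andP[].
    have : D S x <= D S (join_attack x y).
      by apply: D_le => a _; rewrite ffunE => ->.
    have : D S y <= D S (join_attack x y).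
      by apply: D_le => a _; rewrite ffunE => ->; rewrite orbT.
    by move=> hyj hxj hmy hmx h; apply: min_submod.
  rewrite path_Par => /orP[h1|h2] hx hy.
    apply: truncate h1 _ _ hx hy (IH1 _ l1 h1) => //=;
      by rewrite ?subsetUl ?subsetUr.
  rewrite /= !(minC (tdist T1 _)).
  apply: truncate h2 _ _ hx hy (IH2 _ l2 h2) => //=;
    by rewrite ?subsetUl ?subsetUr // disjoint_sym.
Qed.

End TreeDistance.

(** * Decomposition of a series-parallel network into a tree *)

Section Decomposition.
Variable G : network.
Implicit Types (T Q : sp_tree (arcs G)) (p q : seq (arcs G)) (u v m : nodes G).

Fixpoint src T : nodes G :=
  match T with Leaf a => tail_of a | Ser T1 _ | Par T1 _ => src T1 end.

Fixpoint snk T : nodes G :=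
  match T with Leaf a => head_of a | Ser _ T2 => snk T2 | Par T1 _ => snk T1 end.

Fixpoint glued T : bool :=
  match T with
  | Leaf _ => true
  | Ser T1 T2 => [&& glued T1, glued T2 & snk T1 == src T2]
  | Par T1 T2 => [&& glued T1, glued T2, src T1 == src T2 & snk T1 == snk T2]
  end.

Lemma walk_cat u p q v :
  walk u (p ++ q) v = walk u p (last u (map (@head_of G) p)) &&
                      walk (last u (map (@head_of G) p)) q v.
Proof. by elim: p u => [|a p IH] u /=; rewrite ?eqxx // IH andbA. Qed.

Lemma walk_last u p v : walk u p v -> last u (map (@head_of G) p) = v.
Proof. by elim: p u => [|a p IH] u /= => [/eqP|/andP[_ /IH]]. Qed.

Lemma walk_cat_at u p m q v : walk u p m -> walk u (p ++ q) v = walk m q v.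
Proof. by move=> h; rewrite walk_cat (walk_last h) h. Qed.

Lemma nodes_from_cat u p q :
  nodes_from u (p ++ q) = nodes_from u p ++ map (@head_of G) q.
Proof. by rewrite /nodes_from map_cat. Qed.

Lemma glued_walk T p : glued T -> p \in paths T -> walk (src T) p (snk T).
Proof.
elim: T p => [a|T1 IH1 T2 IH2|T1 IH1 T2 IH2] p /=.
- by move=> _; rewrite inE => /eqP -> /=; rewrite !eqxx.
- move=> /and3P[g1 g2 /eqP e] /path_SerP[p1 [p2 [/(IH1 _ g1) h1 /(IH2 _ g2) h2 ->]]].
  by rewrite (walk_cat_at _ _ h1) e.
- move=> /and4P[g1 g2 /eqP e1 /eqP e2]; rewrite -/(paths (Par T1 T2)) path_Par.
  by case/orP=> [/(IH1 _ g1)|/(IH2 _ g2)] //; rewrite e1 e2.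
Qed.

Lemma subtree_glued Q T : subtree Q T -> glued T -> glued Q.
Proof.
by elim=> //= T1 T2 _ IH => [/and3P|/and3P|/and4P|/and4P] [g1 g2 *]; apply: IH.
Qed.

Lemma spn_terminals (N : {set nodes G}) (E : {set arcs G}) u v : spn_on N E u v ->
  [/\ u \in N, v \in N, u != v
    & forall a, a \in E -> [/\ tail_of a \in N, head_of a \in N,
                              head_of a != u & tail_of a != v]].
Proof.
elim=> {N E u v} [a ne|N1 N2 E1 E2 u m v _ [u1 m1 um h1] _ [m2 v2 mv h2] _ eN
  |N1 N2 E1 E2 u v _ [u1 v1 uv h1] _ [_ _ _ h2] _ _].
- split; rewrite ?inE ?eqxx ?orbT //.
  by move=> b /set1P ->; split; rewrite ?inE ?eqxx ?orbT // eq_sym.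
- have only_m x : x \in N1 -> x \in N2 -> x = m.
    by move=> x1 x2; apply/set1P; rewrite -eN inE x1.
  have uN2 : u \notin N2 by apply: contra um => u2; rewrite (only_m u).
  have vN1 : v \notin N1.
    by apply: contra mv => w1; rewrite (only_m v) ?eqxx // eq_sym.
  split; rewrite ?inE ?u1 ?v2 ?orbT //.
    by apply: contraNneq uN2 => ->.
  move=> a; rewrite !inE => /orP[/h1|/h2] [t h nu nv];
    split; rewrite ?t ?h ?orbT //.
    by apply: contraNneq vN1 => <-.
  by apply: contraNneq uN2 => <-.
- split; rewrite ?inE ?u1 ?v1 // => a.
  by rewrite !inE => /orP[/h1|/h2] [t h hu tv];
    split; rewrite ?inE ?t ?h ?orbT.
Qed.

(** The tree of a decomposition lists all the walks between the terminals: no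
    arc enters the source or leaves the sink of a component, so that a walk
    crosses the factors of a series composition one after the other and never
    leaves a factor of a parallel composition. In particular no such walk
    repeats a node. *)
Lemma spn_tree (N : {set nodes G}) (E : {set arcs G}) u v : spn_on N E u v ->
  exists T, [/\ linear_tree T, supp T = E, glued T, src T = u /\ snk T = v
    & forall p, walk u p v -> {subset p <= E} ->
        p \in paths T /\ uniq (nodes_from u p)].
Proof.
elim=> {N E u v} [a ne
  |N1 N2 E1 E2 u m v s1 [T1 [l1 e1 g1 [u1 v1] w1]] s2 [T2 [l2 e2 g2 [u2 v2] w2]] eE eN
  |N1 N2 E1 E2 u v s1 [T1 [l1 e1 g1 [u1 v1] w1]] s2 [T2 [l2 e2 g2 [u2 v2] w2]] eE eN].
- exists (Leaf a); split=> // [[|b [|b' p]] /= wp sp].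
  + by rewrite (negPf ne) in wp.
  + have /set1P eb : b \in [set a] by apply: sp; rewrite inE.
    by rewrite eb /nodes_from /= !inE eqxx ne.
  + have /set1P eb : b \in [set a] by apply: sp; rewrite inE eqxx.
    have /set1P eb' : b' \in [set a] by apply: sp; rewrite !inE eqxx orbT.
    by move: wp; rewrite eb eb' (negPf ne) andbF.
- have [uN1 mN1 um h1] := spn_terminals s1.
  have [mN2 vN2 mv h2] := spn_terminals s2.
  have only_m x : x \in N1 -> x \in N2 -> x = m.
    by move=> x1 x2; apply/set1P; rewrite -eN inE x1.
  have stay2 p x : x \in N2 -> walk x p v -> {subset p <= E1 :|: E2} ->
      {subset p <= E2}.
    elim: p x => [//|a p IH] x x2 /= /andP[/eqP tx wp] sp.
    have aE2 : a \in E2.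
      have := sp a (mem_head _ _); rewrite inE => /orP[/h1[t1 _ _ tm]|//].
      by case/negP: tm; apply/eqP/only_m; rewrite // tx.
    have [_ hN _ _] := h2 a aE2.
    move=> b; rewrite inE => /predU1P[-> //|].
    by apply: IH wp _ b => // b bp; apply: sp; rewrite inE bp orbT.
  have split1 p x : x \in N1 -> walk x p v -> {subset p <= E1 :|: E2} ->
      exists p1 p2, [/\ p = p1 ++ p2, walk x p1 m, {subset p1 <= E1},
        walk m p2 v & {subset p2 <= E2}].
    elim: p x => [|a p IH] x x1 /=.
      by move=> /eqP xv; case/negP: mv; rewrite eq_sym -(only_m v) // -xv.
    move=> /andP[/eqP tx wp] sp.
    have sp' : {subset p <= E1 :|: E2}.
      by move=> b bp; apply: sp; rewrite inE bp orbT.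
    have := sp a (mem_head _ _); rewrite inE => /orP[aE1|aE2].
      have [_ hN1 _ _] := h1 a aE1.
      have [p1 [p2 [-> ww1 ss1 ww2 ss2]]] := IH _ hN1 wp sp'.
      exists (a :: p1), p2; split=> //=; first by rewrite tx eqxx.
      by move=> b; rewrite inE => /predU1P[-> //|/ss1].
    have [t2 _ _ _] := h2 a aE2.
    have xm : x = m by apply: only_m; rewrite // -tx.
    exists [::], (a :: p); split=> //=; rewrite ?xm ?eqxx //.
      by rewrite tx xm eqxx.
    by apply: (stay2 _ m) => //=; rewrite tx xm eqxx.
  have d : [disjoint supp T1 & supp T2] by rewrite -setI_eq0 e1 e2 eE.
  exists (Ser T1 T2); split=> //=; rewrite ?l1 ?l2 ?e1 ?e2 ?g1 ?g2 //.
  + by rewrite -{1}e1 -{1}e2 d.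
  + by rewrite v1 u2 eqxx.
  move=> p wp sp; have [p1 [p2 [-> ww1 ss1 ww2 ss2]]] := split1 p u uN1 wp sp.
  have [t1 q1] := w1 _ ww1 ss1; have [t2 q2] := w2 _ ww2 ss2.
  split; first exact: path_Ser_cat.
  rewrite -[X in is_true X]/(uniq (nodes_from u (p1 ++ p2))).
  rewrite nodes_from_cat cat_uniq q1; move: q2 => /= /andP[mp ->].
  rewrite andbT; apply/hasPn => x /[dup] xp2 /mapP[a ap xa]; apply: contra mp => xp1.
  have [_ hN2 _ _] := h2 a (ss2 _ ap).
  suff <- : x = m by [].
  apply: only_m; last by rewrite xa.
  move: xp1; rewrite inE => /predU1P[->//|/mapP[b bp ->]].
  by have [] := h1 b (ss1 _ bp).
- have [uN1 vN1 uv h1] := spn_terminals s1.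
  have [uN2 vN2 _ h2] := spn_terminals s2.
  have stay (N N' : {set nodes G}) (F F' : {set arcs G}) p x :
      (forall y, y \in N -> y \in N' -> y = u \/ y = v) ->
      (forall a, a \in F -> [/\ tail_of a \in N, head_of a \in N,
                                head_of a != u & tail_of a != v]) ->
      (forall a, a \in F' -> tail_of a \in N' /\ tail_of a != v) ->
      x \in N -> x != u -> walk x p v -> {subset p <= F :|: F'} ->
      {subset p <= F}.
    move=> only hF hF'; elim: p x => [//|a p IH] x xN xu /= /andP[/eqP tx wp] sp.
    have aF : a \in F.
      have := sp a (mem_head _ _); rewrite inE => /orP[//|/hF'[t tv]].
      case: (only x) => [//||e|e]; first by rewrite -tx.
        by rewrite e eqxx in xu.
      by rewrite tx e eqxx in tv.
    have [_ hN hu _] := hF a aF.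
    move=> b; rewrite inE => /predU1P[-> //|].
    by apply: IH wp _ b => // b bp; apply: sp; rewrite inE bp orbT.
  have only y : y \in N1 -> y \in N2 -> y = u \/ y = v.
    by move=> y1 y2; apply/set2P; rewrite -eN inE y1.
  have side p : walk u p v -> {subset p <= E1 :|: E2} ->
      {subset p <= E1} \/ {subset p <= E2}.
    case: p => [|a p] /=; first by left.
    move=> /andP[/eqP ta wp] sp.
    have sp' : {subset p <= E1 :|: E2}.
      by move=> b bp; apply: sp; rewrite inE bp orbT.
    have := sp a (mem_head _ _); rewrite inE => /orP[aE|aE].
      left; have [_ hN hu _] := h1 a aE.
      have := stay N1 N2 E1 E2 p (head_of a) only h1 _ hN hu wp sp'.
      move=> st b; rewrite inE => /predU1P[-> //|]; apply: st.
      by move=> b' /h2[].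
    right; have [_ hN hu _] := h2 a aE.
    have := stay N2 N1 E2 E1 p (head_of a) _ h2 _ hN hu wp.
    rewrite setUC => st b; rewrite inE => /predU1P[-> //|]; apply: st => //.
      by move=> y y2 y1; exact: only.
    by move=> b' /h1[].
  have d : [disjoint supp T1 & supp T2] by rewrite -setI_eq0 e1 e2 eE.
  exists (Par T1 T2); split=> //=; rewrite ?l1 ?l2 ?e1 ?e2 ?g1 ?g2 //.
  + by rewrite -{1}e1 -{1}e2 d.
  + by rewrite u1 u2 v1 v2 !eqxx.
  move=> p wp /(side _ wp)[/(w1 _ wp)|/(w2 _ wp)] [hp up]; split=> //.
    by rewrite mem_cat hp.
  by rewrite mem_cat hp orbT.
Qed.

End Decomposition.

(** * Paths and distances between nodes *)

Section Distance.
Variables (R : realType) (G : network).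
Implicit Types (E : {set arcs G}) (w : arcs G -> R) (u v : nodes G).
Implicit Types (p q : seq (arcs G)).

(** A path repeats no node, hence no arc, so that the bound on the length of
    the candidate paths excludes none. *)
Lemma path_bseq u v p : is_path u v p -> exists b : arcseq G, p = b :> seq _.
Proof.
case/andP=> _ /= /andP[_ /map_uniq up].
have sp : (size p <= #|arcs G|)%N by rewrite -(card_uniqP up) max_card.
by exists (Bseq sp).
Qed.

Lemma arcset_sub p E : reflect {subset p <= E} (arcset p \subset E).
Proof.
apply: (iffP subsetP) => h a; first by move=> ap; apply: h; rewrite inE.
by rewrite inE; exact: h.
Qed.

Lemma dist_le E w u v p : is_path u v p -> {subset p <= E} ->
  (dist E w u v <= (path_length w p)%:E)%E.
Proof.
move=> hp /arcset_sub pE; have [b eb] := path_bseq hp.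
by rewrite eb in hp pE *; apply: bigmin_le_cond; rewrite hp.
Qed.

Lemma dist_ge E w u v (x : R) :
  (forall p, is_path u v p -> {subset p <= E} -> x <= path_length w p) ->
  (x%:E <= dist E w u v)%E.
Proof.
move=> h; apply/bigmin_geP; split; first by rewrite leey.
by move=> p /andP[hp /arcset_sub pE]; rewrite lee_fin; exact: h.
Qed.

Lemma dist_eq E w u v (x : R) p :
  (forall p, is_path u v p -> {subset p <= E} -> x <= path_length w p) ->
  is_path u v p -> {subset p <= E} -> path_length w p = x ->
  dist E w u v = x%:E.
Proof.
move=> ge hp pE e; apply/le_anti; rewrite dist_ge // andbT -e.
exact: dist_le.
Qed.

Lemma dist_attained E w u v (x : R) : (dist E w u v <= x%:E)%E ->
  exists p, [/\ is_path u v p, {subset p <= E} & path_length w p <= x].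
Proof.
move=> h; pose ok (p : arcseq G) :=
  [&& is_path u v p, arcset p \subset E & path_length w p <= x].
have [/existsP[p /and3P[hp /arcset_sub pE lp]]|no] := boolP [exists p, ok p].
  by exists p.
move: h; rewrite leNgt => /negP[]; apply/bigmin_gtP; split; first by rewrite ltey.
move=> p /andP[hp pE]; rewrite lte_fin ltNge; apply: contra no => lp.
by apply/existsP; exists p; rewrite /ok hp pE.
Qed.

End Distance.

(** * From the tree back to the network *)

Section Translation.
Variables (R : realType) (G : network) (Aa : {set arcs G}).
Variables (c delta : arcs G -> R) (Ps : arcseq G).
Hypothesis delta_att : forall a, a \in Aa -> 0 < delta a.
Hypothesis delta_nonatt : forall a, a \notin Aa -> delta a = 0.
Hypothesis Ps_shortest : shortest_path (attacked c delta (no_attack G)) Ps.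
Variable T : sp_tree (arcs G).
Hypothesis T_linear : linear_tree T.
Hypothesis T_supp : supp T = [set: arcs G].
Hypothesis T_glued : glued T.
Hypothesis T_src : src T = source G.
Hypothesis T_snk : snk T = sink G.
Hypothesis T_walk : forall p, walk (source G) p (sink G) ->
  p \in paths T /\ uniq (nodes_from (source G) p).

Implicit Types (p q : seq (arcs G)) (u v m : nodes G).
Implicit Types (x y z : {ffun arcs G -> bool}) (Q : sp_tree (arcs G)).

Local Notation len x := (path_length (attacked c delta x)).
Local Notation D T x := (tdist T (attacked c delta x)).
Local Notation K := (Aa :&: arcset Ps).

Lemma walkE p : walk (source G) p (sink G) = (p \in paths T).
Proof.
apply/idP/idP => [/T_walk[]//|hp].
by rewrite -T_src -T_snk; exact: glued_walk.
Qed.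

Lemma paths_nodes_uniq p : p \in paths T -> uniq (nodes_from (source G) p).
Proof. by rewrite -walkE => /T_walk[]. Qed.

Lemma st_pathE p : st_path p = (p \in paths T).
Proof.
rewrite /st_path /is_path walkE; apply/andP/idP => [[]//|hp].
by split=> //; exact: paths_nodes_uniq.
Qed.

Lemma paths_bseq p : p \in paths T -> exists b : arcseq G, p = b :> seq _.
Proof. by rewrite -st_pathE; exact: path_bseq. Qed.

Lemma in_parallelE a b : in_parallel a b = ~~ in_series T a b.
Proof.
rewrite /in_parallel; have [->|ne] /= := eqVneq a b.
  by rewrite in_series_refl // T_supp.
apply/forallP/idP => [h|/negP ns p].
  apply/negP => /in_seriesP[p hp [ap bp]]; have [p' e] := paths_bseq hp.
  have := h p'; rewrite st_pathE !inE.
  by rewrite -!e hp ap bp.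
apply/implyP; rewrite st_pathE => hp; apply/negP; rewrite !inE => /andP[ap bp].
by apply: ns; apply/in_seriesP; exists (p : seq _).
Qed.

Lemma phiE x : phi c delta x = (D T x)%:E.
Proof.
have [p hp e] := tdist_attained T (attacked c delta x).
apply: dist_eq e; last by move=> a _; rewrite inE.
  by move=> q; rewrite -/(st_path q) st_pathE => hq _; exact: tdist_le.
by rewrite -/(st_path p) st_pathE.
Qed.

Lemma supermodularE : supermodular (phi c delta) <-> supermod (fun x => D T x).
Proof.
by split=> h x y; have := h x y; rewrite !phiE -!EFinD lee_fin.
Qed.

Lemma robust_redundantE a :
  robust_redundant c delta Aa a = jointly_robust_redundant c delta Aa [set a].
Proof. by []. Qed.

(** Deletion can only lengthen the distance, so redundancy says that some
    shortest path survives. *)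
Lemma jointly_robust_redundantP S : jointly_robust_redundant c delta Aa S <->
  forall x, exists p, [/\ p \in paths T, len x p = D T x
    & forall a, a \in p -> a \notin S].
Proof.
split=> [h x|h X XA].
  pose X := [set a in Aa | x a].
  have XA : X \subset Aa by apply/subsetP => a; rewrite inE => /andP[].
  have e : psi c delta set0 X = (D T x)%:E.
    rewrite /psi setC0 -[LHS]/(phi c delta _) phiE; congr (_%:E).
    by apply: (D_eq _ delta_nonatt) => a _ aA; rewrite ffunE inE aA.
  have : (psi c delta S (X :\: S) <= (D T x)%:E)%E by rewrite -h // e.
  move=> /dist_attained[p [hp pS lp]]; exists p.
  have pS' a (ap : a \in p) : a \notin S by have := pS a ap; rewrite inE.
  have hpT : p \in paths T by rewrite -st_pathE.
  split=> //; apply/le_anti; rewrite tdist_le // andbT.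
  rewrite -(@len_eq _ _ c delta _ delta_nonatt [ffun a => a \in X :\: S]) //.
  by move=> a ap aA; rewrite ffunE !inE aA pS'.
rewrite /psi setC0 -[LHS]/(phi c delta _) phiE.
have [p [hp lp pS]] := h [ffun a => a \in X].
have e q : {subset q <= ~: S} ->
    len [ffun a => a \in X :\: S] q = len [ffun a => a \in X] q.
  move=> qS; apply: (len_eq c delta_nonatt) => a /qS; rewrite !ffunE !inE => -> _.
  by [].
have pS' : {subset p <= ~: S} by move=> a /pS; rewrite inE.
apply/esym/(@dist_eq _ _ _ _ _ _ _ p) => //.
- move=> q; rewrite -/(st_path q) st_pathE => hq qS; rewrite e //.
  exact: tdist_le.
- by rewrite -/(st_path p) st_pathE.
- by rewrite e.
Qed.

Lemma Ps_optimum : optimum c delta Aa K T Ps.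
Proof.
case: Ps_shortest => hP minP; rewrite st_pathE in hP; split=> //.
  apply/le_anti; rewrite tdist_le // andbT.
  have [q hq <-] := tdist_attained T (attacked c delta (no_attack G)).
  have [q' e] := paths_bseq hq; rewrite e; apply: minP.
  by rewrite -e st_pathE.
by move=> a _; rewrite !inE.
Qed.

Lemma cond_parallel_pair k1 k2 a :
  (a \in cond_parallel [set k1; k2] set0) =
  ~~ (in_series T a k1 || in_series T a k2).
Proof.
rewrite inE set0D negb_or -!in_parallelE.
apply/andP/andP => [[/forall_inP h _]|[h1 h2]].
  by split; apply: h; rewrite !inE eqxx ?orbT.
by split; apply/forall_inP => b; rewrite !inE // => /orP[]/eqP ->.
Qed.

Lemma cond_parallel_single k :
  cond_parallel [set k] K = parallel_only K T k.
Proof.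
apply/setP => a; rewrite !inE T_supp in_setT setIT /=.
congr (_ && _); last by apply: eq_forallb => b; rewrite in_parallelE negbK.
apply/forall_inP/idP => [/(_ k)|h b /set1P ->]; last by rewrite in_parallelE.
by rewrite in_parallelE; apply; rewrite inE.
Qed.

Lemma joint_condition1P :
  joint_condition1 c delta Aa K <-> pairs_redundant c delta K T.
Proof.
split=> [h k1 k2 /setIP[k1K _] /setIP[k2K _] ne x|h A' A'K /eqP/cards2P[k1 [k2 [ne e]]]].
  have A'K : [set k1; k2] \subset K.
    by apply/subsetP => a /set2P[] ->.
  have A'2 : #|[set k1; k2]| = 2%N by rewrite cards2 ne.
  have /jointly_robust_redundantP/(_ x)[p [hp lp av]] := h _ A'K A'2.
  exists p; split=> // a /av.
  by rewrite cond_parallel_pair negbK.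
apply/jointly_robust_redundantP => x; rewrite e in A'K *.
have kK k : k \in [set k1; k2] -> k \in K :&: supp T.
  by move=> /(subsetP A'K) kK; rewrite inE kK T_supp inE.
have [||p [hp lp av]] := h k1 k2 _ _ ne x; rewrite ?kK ?inE ?eqxx ?orbT //.
exists p; split=> // a /av.
by rewrite cond_parallel_pair negbK.
Qed.

(** Deleting fewer arcs preserves redundancy. *)
Lemma joint_condition1_sep :
  joint_condition1 c delta Aa K -> condition1 c delta Aa K.
Proof.
move=> h A' A'K A'2 a aC.
rewrite robust_redundantE.
have /jointly_robust_redundantP hj := h _ A'K A'2.
apply/jointly_robust_redundantP => x; have [p [hp lp av]] := hj x.
exists p; split=> // b /av; apply: contra => /set1P ->.
exact: aC.
Qed.

(** If the shortest path is unique, it must be the one that avoids each of the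
    redundant arcs. *)
Lemma condition1_joint :
  (forall x, unique_shortest_path (attacked c delta x)) ->
  condition1 c delta Aa K -> joint_condition1 c delta Aa K.
Proof.
move=> uniq_sp h A' A'K A'2; apply/jointly_robust_redundantP => x.
have [p hp lp] := tdist_attained T (attacked c delta x).
have short q : q \in paths T -> len x q = D T x ->
    exists2 b : arcseq G, shortest_path (attacked c delta x) b & q = b :> seq _.
  move=> hq lq; have [b e] := paths_bseq hq; exists b => //.
  rewrite /shortest_path st_pathE -e; split=> // r; rewrite st_pathE lq.
  exact: tdist_le.
exists p; split=> // a ap; apply/negP => /(h _ A'K A'2).
rewrite robust_redundantE.
move=> /jointly_robust_redundantP/(_ x)[q [hq lq av]].
have [b sb eb] := short p hp lp; have [b' sb' eb'] := short q hq lq.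
have := av a; rewrite eb' -(uniq_sp x _ _ sb sb') -eb inE eqxx.
by move=> /(_ ap).
Qed.

Lemma Ps_strict : unique_shortest_path (attacked c delta (no_attack G)) ->
  forall p, p \in paths T -> p != Ps -> D T (no_attack G) < len (no_attack G) p.
Proof.
move=> uniq_sp p hp; apply: contraNlt => le; have [b e] := paths_bseq hp.
rewrite e; apply/eqP; congr (bseqval _); apply: uniq_sp => //.
split; first by rewrite st_pathE -e.
move=> q; rewrite st_pathE => hq; rewrite -e; apply: le_trans le _.
exact: tdist_le.
Qed.

(** * Nodes along a path *)

Lemma nodes_from_split u p m q : walk u p m ->
  nodes_from u (p ++ q) = belast u (map (@head_of G) p) ++ nodes_from m q.
Proof.
move=> /walk_last e.
by rewrite nodes_from_cat /nodes_from lastI e cat_rcons.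
Qed.

Lemma walk_terminals u v u' v' p : p != [::] ->
  walk u p v -> walk u' p v' -> u = u' /\ v = v'.
Proof.
case: p => // a p _ w w'; split; last by rewrite -(walk_last w) -(walk_last w').
by case/andP: w => /eqP <- _; case/andP: w' => /eqP <-.
Qed.

Lemma walk_split p1 q p2 u v : q != [::] -> p1 ++ q ++ p2 \in paths T ->
  walk u q v -> walk (source G) p1 u /\ walk v p2 (sink G).
Proof.
move=> q0; rewrite -walkE walk_cat walk_cat => /andP[w1 /andP[wq w2]] w.
by have [-> ->] := walk_terminals q0 w wq.
Qed.

Lemma loop_free p1 q p2 m : p1 ++ q ++ p2 \in paths T ->
  walk (source G) p1 m -> walk m q m -> q = [::].
Proof.
move=> /paths_nodes_uniq un w1; move: un.
rewrite (nodes_from_split _ w1) cat_uniq => /and3P[_ _].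
rewrite nodes_from_cat cat_uniq => /andP[+ _].
case: q => // a q /= /andP[/negP out _] /andP[_ /walk_last wl].
by case: out; rewrite -{1}wl mem_last.
Qed.

(** Nodes are not repeated, so the position of a node on a path tells where
    the path is to be cut. *)
Lemma pos_split p1 p2 m : p1 ++ p2 \in paths T -> walk (source G) p1 m ->
  pos m (p1 ++ p2) = size p1.
Proof.
move=> /paths_nodes_uniq un w1; rewrite /pos; move: un.
rewrite (nodes_from_split _ w1) cat_uniq index_cat => /and3P[_ /hasPn out _].
rewrite (negPf (out m _)) ?mem_head // size_belast size_map /= eqxx.
exact: addn0.
Qed.

Section Envelope.
Variables (k : arcs G) (Q : sp_tree (arcs G)).
Hypothesis env : envelope K T k Q.

Let Q_sub : subtree Q T. Proof. by case: env. Qed.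

Lemma envelope_walk q : q \in paths Q -> walk (src Q) q (snk Q).
Proof. exact/glued_walk/(subtree_glued Q_sub). Qed.

Lemma envelope_split p a : p \in paths T -> a \in p -> a \in supp Q ->
  exists p1 q p2, [/\ p = p1 ++ q ++ p2, q \in paths Q,
    forall b, b \in p1 ++ p2 -> b \notin supp Q
    & walk (source G) p1 (src Q) /\ walk (snk Q) p2 (sink G)].
Proof.
move=> hp ap aQ; have [p1 [q [p2 [e hq out _]]]] := subtree_split T_linear Q_sub hp ap aQ.
exists p1, q, p2; split=> //; rewrite e in hp.
exact: walk_split (path_nonempty hq) hp (envelope_walk hq).
Qed.

Lemma envelope_Ps : exists p1 q p2, [/\ Ps = p1 ++ q ++ p2 :> seq _,
    optimum c delta Aa K Q q,
    forall b, b \in p1 ++ p2 -> b \notin supp Q,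
    forall q', q' \in paths Q -> p1 ++ q' ++ p2 \in paths T
    & walk (source G) p1 (src Q) /\ walk (snk Q) p2 (sink G)].
Proof.
have [kK kQ] := envelope_in env.
have [p1 [q [p2 [e o out ins]]]] :=
  optimum_subtree T_linear Ps_optimum Q_sub kK kQ.
exists p1, q, p2; split=> //; have [hq _ _] := o.
exact: walk_split (path_nonempty hq) (ins _ hq) (envelope_walk hq).
Qed.

(** A walk between the terminals of Q extends to a path. If this path misses
    Q, then its arcs between the terminals are parallel to k alone, which puts
    them into Q after all. *)
Lemma envelope_walks q : walk (src Q) q (snk Q) -> q \in paths Q.
Proof.
have [p1 [q0 [p2 [ePs [hq0 _ _] out ins [w1 w2]]]]] := envelope_Ps.
move=> w; have hp : p1 ++ q ++ p2 \in paths T.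
  by rewrite -walkE (walk_cat_at _ _ w1) (walk_cat_at _ _ w).
have [a /andP[aq aQ]|no] := pickP (fun a => (a \in q) && (a \in supp Q)).
  have [|p1' [q' [p2' [e hq' _ [w1' _]]]]] := envelope_split hp _ aQ.
    by rewrite !mem_cat aq orbT.
  have s1 : size p1 = size p1'.
    rewrite -(pos_split hp w1) e pos_split // -e //.
  have := e; rewrite !catA => e'; rewrite !catA in hp.
  have s2 : size (p1 ++ q) = size (p1' ++ q').
    rewrite -(@pos_split (p1 ++ q) p2 (snk Q)) //; last first.
      by rewrite (walk_cat_at _ _ w1).
    rewrite e' pos_split // -?e' //.
    by rewrite (walk_cat_at _ _ w1') envelope_walk.
  move/eqP: e'; rewrite eqseq_cat // => /andP[+ _].
  by rewrite eqseq_cat // => /andP[_ /eqP ->].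
exfalso.
have qne : q != [::].
  apply: contraNneq (path_nonempty hq0) => q_nil.
  move: w; rewrite q_nil => /= /eqP e.
  apply/eqP/(loop_free (ins _ hq0) w1).
  by rewrite {2}e envelope_walk.
case: q qne w hp no => // a q _ w hp no.
have aQ : a \notin supp Q by have := no a; rewrite mem_head /= => ->.
case/negP: aQ; have [_ eK /subsetP gQ _] := env; apply: gQ.
have ta : tail_of a = src Q by case/andP: w => /eqP.
rewrite inE T_supp inE /=; apply/andP; split.
  apply/negP => /in_seriesP[p hp' [ap kp]].
  have [kK kQ] := envelope_in env.
  have [r1 [r [r2 [e hr out' [v1 v2]]]]] := envelope_split hp' kp kQ.
  rewrite e in hp'.
  move: ap; rewrite e mem_cat [_ \in r ++ _]mem_cat orbCA => /orP[ar|].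
    by have := path_supp hr ar; apply/negP; have := no a; rewrite mem_head /= => ->.
  case/orP=> /splitPr er; case: er hp' v1 v2 {e out'} => i1 i2.
    rewrite -catA => hp' + _; rewrite walk_cat; case/andP=> v1 v2.
    have e : last (source G) (map (@head_of G) i1) = src Q.
      by rewrite -ta; case/andP: v2 => /eqP.
    by rewrite e in v1 v2; have := loop_free hp' v1 v2.
  rewrite (catA r) => hp' v1; rewrite walk_cat => /andP[v2 /= /andP[/eqP v3 _]].
  have r_nil : r ++ i1 = [::].
    apply: loop_free hp' v1 _.
    by rewrite (walk_cat_at _ _ (envelope_walk hr)) -ta v3.
  by have := path_nonempty hr; case: (r) r_nil.
apply/forall_inP => b; rewrite !inE andbT => /and3P[bk bA bP].
have bQ : b \notin supp Q.
  apply: contra bk => bQ; rewrite -in_set1 -eK !inE bA bQ.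
  by rewrite bP.
apply/in_seriesP; exists (p1 ++ (a :: q) ++ p2) => //.
rewrite !mem_cat mem_head orbT; split=> //.
move: bP; rewrite ePs mem_cat [_ \in q0 ++ _]mem_cat => /or3P[->//|bq0|->].
  by rewrite (path_supp hq0 bq0) in bQ.
by rewrite !orbT.
Qed.

Lemma envelope_dist (w : arcs G -> R) :
  dist [set: arcs G] w (src Q) (snk Q) = (tdist Q w)%:E.
Proof.
have [q hq e] := tdist_attained Q w.
have [p1 [q0 [p2 [_ [hq0 _ _] _ ins [w1 _]]]]] := envelope_Ps.
apply: dist_eq e; last by move=> a _; rewrite inE.
  by move=> r /andP[/envelope_walks hr _] _; exact: tdist_le.
rewrite /is_path envelope_walk //=.
have := paths_nodes_uniq (ins _ hq).
rewrite (nodes_from_split _ w1) cat_uniq => /and3P[_ _].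
by rewrite nodes_from_cat cat_uniq => /and3P[].
Qed.

Local Notation g := (cond_parallel [set k] K).

Lemma envelope_parallel : g \subset supp Q.
Proof. by rewrite cond_parallel_single; case: env. Qed.

Lemma envelope_parallel_path : exists2 q, q \in paths Q & {subset q <= g}.
Proof. by rewrite cond_parallel_single; case: env. Qed.

Lemma envelope_source : subnet_source g (src Q).
Proof.
split.
  have [q hq qg] := envelope_parallel_path.
  have := envelope_walk hq; have := path_nonempty hq.
  case: q hq qg => // a q _ qg _ /andP[/eqP <- _].
  apply/bigcupP; exists a; first by apply: qg; rewrite mem_head.
  by rewrite !inE eqxx.
move=> p; rewrite st_pathE => hp /set0Pn[a /setIP[]]; rewrite inE => ap ag.
have aQ := subsetP envelope_parallel a ag.
have [p1 [q [p2 [e hq out [w1 w2]]]]] := envelope_split hp ap aQ.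
rewrite e in hp *; split.
  by rewrite /passes_through (nodes_from_split _ w1) mem_cat mem_head orbT.
move=> b; rewrite (pos_split hp w1) take_size_cat // => bp1.
have := out b; rewrite mem_cat bp1 => /(_ isT); apply: contra.
exact: (subsetP envelope_parallel).
Qed.

Lemma envelope_sink : subnet_sink g (snk Q).
Proof.
split.
  have [q hq qg] := envelope_parallel_path.
  have := walk_last (envelope_walk hq); have := path_nonempty hq.
  case/lastP: q hq qg => // q a _ qg _.
  rewrite map_rcons last_rcons => <-.
  apply/bigcupP; exists a; first by apply: qg; rewrite mem_rcons mem_head.
  by rewrite !inE eqxx orbT.
move=> p; rewrite st_pathE => hp /set0Pn[a /setIP[]]; rewrite inE => ap ag.
have aQ := subsetP envelope_parallel a ag.
have [p1 [q [p2 [e hq out [w1 w2]]]]] := envelope_split hp ap aQ.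
rewrite catA in e; rewrite e in hp *.
have w1q : walk (source G) (p1 ++ q) (snk Q).
  by rewrite (walk_cat_at _ _ w1) envelope_walk.
split.
  by rewrite /passes_through (nodes_from_split _ w1q) mem_cat mem_head orbT.
move=> b; rewrite (pos_split hp w1q) drop_size_cat // => bp2.
have := out b; rewrite mem_cat bp2 orbT => /(_ isT); apply: contra.
exact: (subsetP envelope_parallel).
Qed.

(** An end node of an arc of g_k lies on a crossing of Q, which can be put
    between p1 and p2; the resulting path does not repeat the node. *)
Lemma incident_between p1 q p2 u : p1 ++ q ++ p2 \in paths T ->
  walk (source G) p1 (src Q) ->
  (forall q', q' \in paths Q -> p1 ++ q' ++ p2 \in paths T) ->
  u \in incident_nodes g ->
  u \notin belast (source G) (map (@head_of G) p1) /\
  u \notin map (@head_of G) p2.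
Proof.
move=> hp w1 ins /bigcupP[a ag ua].
have [q' hq' aq'] := supp_on_path (subsetP envelope_parallel a ag).
have uq' : u \in nodes_from (src Q) q'.
  have wq' := envelope_walk hq'; move: wq'; case/splitPr: aq' => i1 i2.
  rewrite walk_cat => /andP[_ /= /andP[/eqP ta _]].
  rewrite nodes_from_cat mem_cat; case/set2P: ua => ->.
    by rewrite ta; apply/orP; left; exact: mem_last.
  by rewrite mem_head orbT.
have := paths_nodes_uniq (ins _ hq').
rewrite (nodes_from_split _ w1) cat_uniq => /and3P[_ /hasPn out].
rewrite nodes_from_cat cat_uniq => /and3P[_ /hasPn out2 _]; split.
  by apply: out; rewrite nodes_from_cat mem_cat uq'.
by apply/negP => /out2; rewrite /= uq'.
Qed.

(** On a path that enters g_k right at the source of Q, no arc before u lies in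
    g_k, so u comes no later than that source; it cannot come earlier because
    it is an end node of an arc of Q. *)
Lemma subnet_source_uniq u : subnet_source g u -> u = src Q.
Proof.
move=> [ui us].
have [p1 [q0 [p2 [_ [hq0 _ _] _ ins [w1 _]]]]] := envelope_Ps.
have [q hq qg] := envelope_parallel_path.
have hp := ins _ hq; have [p e] := paths_bseq hp.
have [up1 up2] := incident_between hp w1 ins ui.
case: q hq qg hp e (path_nonempty hq) => // a q hq qg hp e _.
have ag : a \in g by apply: qg; rewrite mem_head.
have [||pu before] := us p; first by rewrite st_pathE -e.
  by apply/set0Pn; exists a; rewrite inE ag inE -e mem_cat mem_head orbT.
have le : (pos u p <= size p1)%N.
  rewrite leqNgt; apply/negP => lt.
  suff /before : a \in take (pos u p) p by rewrite ag.
  rewrite -(subnKC lt) takeD mem_cat -e /= -cat_rcons.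
  by rewrite take_size_cat ?size_rcons // mem_rcons mem_head.
move: le pu; rewrite /pos /passes_through -e (nodes_from_split _ w1).
rewrite index_cat mem_cat (negPf up1) /= size_belast size_map.
rewrite -{2}(addn0 (size p1)) leq_add2l leqn0.
by case: ifP => // /eqP ->.
Qed.

Lemma subnet_sink_uniq v : subnet_sink g v -> v = snk Q.
Proof.
move=> [vi vs].
have [p1 [q0 [p2 [_ [hq0 _ _] _ ins [w1 _]]]]] := envelope_Ps.
have [q hq qg] := envelope_parallel_path.
have hp := ins _ hq; have [p e] := paths_bseq hp.
have [vp1 vp2] := incident_between hp w1 ins vi.
have wq := envelope_walk hq.
case/lastP: q hq qg hp e wq (path_nonempty hq) => // q a hq qg hp e wq _.
have ag : a \in g by apply: qg; rewrite mem_rcons mem_head.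
have [||pv after] := vs p; first by rewrite st_pathE -e.
  apply/set0Pn; exists a; rewrite inE ag inE -e mem_cat.
  by rewrite [_ \in rcons _ _ ++ _]mem_cat mem_rcons mem_head orbT.
have ge : (size (p1 ++ q) < pos v p)%N.
  rewrite ltnNge; apply/negP => le.
  suff /after : a \in drop (pos v p) p by rewrite ag.
  move: (pos v p) le => i le; rewrite -e cat_rcons catA drop_cat.
  case: ltngtP le => // [lt _|-> _]; first by rewrite mem_cat mem_head orbT.
  by rewrite subnn drop0 mem_head.
have w1q : walk (source G) (p1 ++ rcons q a) (snk Q).
  by rewrite (walk_cat_at _ _ w1).
move: ge pv; rewrite /pos /passes_through -e catA (nodes_from_split _ w1q).
rewrite index_cat mem_cat inE (negPf vp2) orbF.
case: ifP => [vb ge _|_ _ /=]; last by move/eqP.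
have := index_mem v (belast (source G) (map (@head_of G) (p1 ++ rcons q a))).
rewrite vb size_belast size_map -rcons_cat size_rcons ltnS leqNgt.
by move: ge; rewrite -rcons_cat => ->.
Qed.

End Envelope.

Lemma condition2_of_supermod : pairs_redundant c delta K T ->
  supermod (fun x => D T x) -> condition2 c delta Aa K.
Proof.
move=> r sm k kK /= g0.
have kT : k \in K :&: supp T by rewrite T_supp setIT.
have g0' := g0; rewrite cond_parallel_single in g0'.
have [Q env sQ] := envelope_exists delta_nonatt T_linear Ps_optimum r sm kT g0'.
exists (src Q), (snk Q).
split; [exact: envelope_source|exact: envelope_sink|move=> z _ x y].
rewrite !(envelope_dist env) -!EFinD lee_fin.
set S := _ :&: Aa.
have -> : override S (join_attack x y) z =
          join_attack (override S x z) (override S y z).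
  by apply/ffunP => a; rewrite !ffunE; case: ifP => // _; rewrite orbb.
have -> : override S (meet_attack x y) z =
          meet_attack (override S x z) (override S y z).
  by apply/ffunP => a; rewrite !ffunE; case: ifP => // _; rewrite andbb.
exact: sQ.
Qed.

(** The entries of an attack outside g_k do not change the distance across
    the envelope of k, once k is attacked, so fixing them is no restriction. *)
Lemma envelopes_of_condition2 :
  condition2 c delta Aa K -> envelopes_supermod c delta K T.
Proof.
move=> h k Q env x y xk yk; have [kK kQ] := envelope_in env.
have [sQ eK _ _] := env.
have g0 : cond_parallel [set k] K != set0.
  have [q hq qg] := envelope_parallel_path env.
  case: q hq qg (path_nonempty hq) => // a q _ qg _.
  by apply/set0Pn; exists a; apply: qg; rewrite mem_head.
have [u [v [us vs sm]]] := h k kK g0.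
have eu := subnet_source_uniq env us; have ev := subnet_sink_uniq env vs.
have [p1 [q0 [p2 [ePs oQ out ins _]]]] := envelope_Ps env.
set S := cond_parallel [set k] K :&: Aa in sm.
have inS a : a \in supp Q -> a \in Aa -> ~~ in_series Q a k -> a \in S.
  move=> aQ aA ns; rewrite inE aA andbT cond_parallel_single inE T_supp inE /=.
  rewrite (subtree_in_series T_linear sQ) // ns /=.
  apply/forall_inP => b; rewrite !inE andbT => /and3P[bk bA bP].
  have [q' hq' aq'] := supp_on_path aQ.
  apply/in_seriesP; exists (p1 ++ q' ++ p2); first exact: ins.
  split; first by rewrite !mem_cat aq' orbT.
  move: bP; rewrite ePs !mem_cat => /or3P[->//|bq0|->]; last by rewrite !orbT.
  have : b \in K :&: supp Q.
    have [hq0 _ _] := oQ.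
    by rewrite !inE bA ePs !mem_cat bq0 orbT (path_supp hq0).
  by rewrite eK inE (negPf bk).
have kS : k \notin S.
  rewrite inE negb_and cond_parallel_single inE in_series_refl ?T_supp ?inE //.
have restore z : z k -> D Q (override S z x) = D Q z.
  move=> zk.
  apply: (parallel_arcs_determine delta_att delta_nonatt _ oQ eK).
    exact: subtree_linear sQ T_linear.
  move=> a aQ aA /orP[/eqP ->|ns]; first by rewrite ffunE (negPf kS) zk xk.
  by rewrite ffunE inS.
have := sm x xk x y; rewrite eu ev !(envelope_dist env) -!EFinD lee_fin.
by rewrite !restore // ffunE xk ?yk.
Qed.

(** * Submodularity *)

Lemma submodularE : submodular (phi c delta) <->
  forall x y, D T (join_attack x y) + D T (meet_attack x y) <= D T x + D T y.
Proof.
by split=> h x y; have := h x y; rewrite !phiE -!EFinD lee_fin.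
Qed.

(** Attacking an arc a off the shortest path has no effect if no other arc is
    attacked, hence none at all when the effects of attacks can only decrease.
    So a shortest path under an attack of a and others, which does not contain
    a, is also shortest if a is spared. *)
Lemma robust_redundant_of_submodular a : submodular (phi c delta) ->
  a \in Aa :\: arcset Ps -> robust_redundant c delta Aa a.
Proof.
move=> /submodularE sm /setDP[aA]; rewrite inE => aP.
rewrite robust_redundantE.
apply/jointly_robust_redundantP => x.
pose e : {ffun arcs G -> bool} := [ffun b => b == a].
pose y : {ffun arcs G -> bool} := [ffun b => x b && (b != a)].
have [hP lP _] := Ps_optimum.
have e0 : D T e <= D T (no_attack G).
  rewrite -lP (len_eq c delta_nonatt (y := e)); first exact: tdist_le.
  by move=> b bP _; rewrite !ffunE; apply/esym; apply: contraTF bP => /eqP ->.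
have Xy : D T (join_attack e y) <= D T y.
  have := sm e y; suff -> : meet_attack e y = no_attack G by lra.
  by apply/ffunP => b; rewrite !ffunE; case: eqVneq; rewrite ?andbF.
have yx : D T y <= D T x.
  by apply: (D_le _ delta_att delta_nonatt) => b _; rewrite ffunE => /andP[].
have [p hp lp] := tdist_attained T (attacked c delta (join_attack e y)).
have ap : a \notin p.
  apply/negP => ap.
  have := tdist_le (attacked c delta y) hp.
  have : len (join_attack e y) p = len y p + delta a.
    apply: len_attack ap _ _ _; first exact: path_uniq T_linear hp.
    - by rewrite ffunE eqxx andbF.
    - by rewrite !ffunE eqxx.
    - by move=> b _ /negPf ba; rewrite [join_attack e y b]ffunE [e b]ffunE ba.
  by move: (delta_att aA) Xy lp; lra.
exists p; split=> //; last by move=> b bp; rewrite inE; apply: contraNneq ap => <-.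
apply/le_anti; rewrite tdist_le // andbT (le_trans _ yx) // (le_trans _ Xy) //.
rewrite -lp; apply: (len_le _ delta_att delta_nonatt) => b _ xb.
by rewrite !ffunE xb /=; case: eqP.
Qed.

Lemma submodular_of_robust_redundant :
  (forall a, a \in Aa :\: arcset Ps -> robust_redundant c delta Aa a) ->
  submodular (phi c delta).
Proof.
move=> red; apply/submodularE.
pose on_Ps x : {ffun arcs G -> bool} := [ffun a => x a && (a \in Ps)].
have one a x y : a \notin Ps -> (forall b, b != a -> x b -> y b) ->
    D T x <= D T y.
  move=> aP xy; have [aA|aA] := boolP (a \in Aa); last first.
    apply: tdist_mono => b _; have [->|ba] := eqVneq b a.
      by rewrite /attacked delta_nonatt // !mul0r.
    exact/(attacked_le _ delta_att delta_nonatt)/xy.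
  have aR : a \in Aa :\: arcset Ps by rewrite !inE aP.
  have := red a aR; rewrite robust_redundantE.
  move=> /jointly_robust_redundantP/(_ y)[p [hp <- av]].
  apply: le_trans (tdist_le _ hp) _.
  apply: (len_le _ delta_att delta_nonatt) => b bp; apply: xy.
  by have := av b bp; rewrite inE.
have restrict x : D T x = D T (on_Ps x).
  apply/le_anti/andP; split; last first.
    by apply: (D_le _ delta_att delta_nonatt) => a _; rewrite ffunE => /andP[].
  pose spare (s : seq (arcs G)) : {ffun arcs G -> bool} :=
    [ffun a => x a && ((a \in Ps) || (a \notin s))].
  (* The attacks on arcs off Ps are dropped one at a time. *)
  have drop s : D T x <= D T (spare s).
    elim: s => [|a s IH].
      by apply: (D_le _ delta_att delta_nonatt) => a _ xa; rewrite ffunE xa orbT.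
    apply: le_trans IH _; have [aP|aP] := boolP (a \in Ps).
      apply: (D_le _ delta_att delta_nonatt) => b _; rewrite !ffunE inE negb_or.
      by have [->|] := eqVneq b a; [rewrite aP|].
    by apply: (one a) => // b ba; rewrite !ffunE inE (negPf ba).
  apply: le_trans (drop (enum (arcs G))) _.
  apply: (D_le _ delta_att delta_nonatt) => a _.
  by rewrite !ffunE mem_enum orbF.
move=> x y; rewrite (restrict (join_attack x y)) (restrict (meet_attack x y)).
rewrite (restrict x) (restrict y).
have -> : on_Ps (join_attack x y) = join_attack (on_Ps x) (on_Ps y).
  by apply/ffunP => a; rewrite !ffunE andb_orl.
have -> : on_Ps (meet_attack x y) = meet_attack (on_Ps x) (on_Ps y).
  by apply/ffunP => a; rewrite !ffunE andbACA andbb.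
have [hP _ _] := Ps_optimum.
by apply: (submod_along_path _ delta_att delta_nonatt T_linear hP) => a _;
  rewrite ffunE => /andP[].
Qed.

Lemma phi_const : K = set0 -> forall x, phi c delta x = phi c delta (no_attack G).
Proof.
move=> K0 x; rewrite !phiE; congr (_%:E).
apply: (spared_distance delta_att delta_nonatt Ps_optimum) => a _.
by rewrite K0 inE.
Qed.

Lemma supermodular_iff_joint :
  unique_shortest_path (attacked c delta (no_attack G)) ->
  supermodular (phi c delta) <->
  K = set0 \/ (joint_condition1 c delta Aa K /\ condition2 c delta Aa K).
Proof.
move=> uniq0; split=> [/supermodularE sm|[K0|[/joint_condition1P r h2]]].
- have r := supermod_pairs_redundant delta_att delta_nonatt T_linear Ps_optimum
    (Ps_strict uniq0) sm.
  by right; split; [apply/joint_condition1P|exact: condition2_of_supermod].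
- by move=> x y; rewrite (phi_const K0 x) (phi_const K0 y) (phi_const K0 (join_attack _ _))
    (phi_const K0 (meet_attack _ _)).
- apply/supermodularE.
  exact: (supermod_of_conditions delta_att delta_nonatt T_linear Ps_optimum r
            (envelopes_of_condition2 h2)).
Qed.

Lemma supermodular_iff_separate :
  (forall x, unique_shortest_path (attacked c delta x)) ->
  supermodular (phi c delta) <->
  K = set0 \/ (condition1 c delta Aa K /\ condition2 c delta Aa K).
Proof.
move=> uniq_sp; split.
  move=> /(supermodular_iff_joint (uniq_sp _))[K0|[h1 h2]]; first by left.
  by right; split=> //; exact: joint_condition1_sep.
move=> h; apply/(supermodular_iff_joint (uniq_sp _)).
case: h => [K0|[h1 h2]]; first by left.
by right; split=> //; exact: condition1_joint.
Qed.

Lemma submodular_iff : submodular (phi c delta) <->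
  K = set0 \/ forall a, a \in Aa :\: arcset Ps -> robust_redundant c delta Aa a.
Proof.
split=> [sm|[K0|]]; last exact: submodular_of_robust_redundant.
  by right=> a; exact: robust_redundant_of_submodular.
move=> x y; rewrite (phi_const K0 x) (phi_const K0 y).
by rewrite (phi_const K0 (join_attack _ _)) (phi_const K0 (meet_attack _ _)).
Qed.

End Translation.

Theorem proposition13 (R : realType) (G : network) (Aa : {set arcs G})
    (c delta : arcs G -> R) (Ps : arcseq G)
    (hG : simplified_spn Aa)
    (hc : forall a, 0 <= c a)
    (hdelta_att : forall a, a \in Aa -> 0 < delta a)
    (hdelta_nonatt : forall a, a \notin Aa -> delta a = 0)
    (hPs : shortest_path (attacked c delta (no_attack G)) Ps) :
  let K := Aa :&: arcset Ps in
  [/\ (forall x, unique_shortest_path (attacked c delta x)) ->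
        (supermodular (phi c delta) <->
         K = set0 \/ (condition1 c delta Aa K /\ condition2 c delta Aa K)),
      unique_shortest_path (attacked c delta (no_attack G)) ->
        (supermodular (phi c delta) <->
         K = set0 \/
         (joint_condition1 c delta Aa K /\ condition2 c delta Aa K))
    & submodular (phi c delta) <->
        K = set0 \/
        forall a, a \in Aa :\: arcset Ps -> robust_redundant c delta Aa a].
Proof.
have [T [l sT gT [uT vT] wT]] := spn_tree hG.1.
have wT' p : walk (source G) p (sink G) ->
    p \in paths T /\ uniq (nodes_from (source G) p).
  by move=> w; apply: wT => // a _; rewrite inE.
split.
- exact: (supermodular_iff_separate hdelta_att hdelta_nonatt hPs l sT gT uT vT).
- exact: (supermodular_iff_joint hdelta_att hdelta_nonatt hPs l sT gT uT vT).
- exact: (submodular_iff hdelta_att hdelta_nonatt hPs l gT uT vT).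
Qed.
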